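(* Let $\lambda>0$ and let $\Omega=\{x\in\mathbb{R}^2 : |x|\le 1\}$ be the unit disk. For odd $m=2L+1$, let $V_m^e=\mathrm{span}\{e_j : -L\le j\le L\}$ be the space spanned by the plane waves $$e_j(x)=e^{i\mathbf{k}_j\cdot x},\qquad \mathbf{k}_j=\lambda\left(\cos\left(\tfrac{2j\pi}{m}\right),\sin\left(\tfrac{2j\pi}{m}\right)\right),\qquad j=-L,\dots,L,$$ and let $\nu_\alpha$ be the probability measure $\nu_\alpha=(1-\alpha)\frac{dx}{|\Omega|}+\alpha\frac{d\sigma}{|\partial\Omega|}$ on $\Omega$. Then: (1) (Case $\alpha=0$, the uniform measure.) For every $c_1<1/16$ there is a constant $c_0$, depending on $c_1$ and $\lambda$, such that for all sufficiently large $m$, $$K(V_m^e,\nu_0)\ \ge\ c_0+c_1m^2.$$ (2) (Case $0<\alpha<1$.) For every $C_2>1$ there is a constant $C_1$, depending on $C_2$, $\lambda$ and $\alpha$, such that for all sufficiently large $m$, $$K(V_m^e,\nu_\alpha)\ \le\ C_1+C_2\frac{m}{\alpha}.$$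
   Context: Spans are over $\mathbb{C}$. $dx$ is Lebesgue measure on $\Omega$, $|\Omega|$ the area of $\Omega$, $d\sigma$ the arc-length measure on the boundary $\partial\Omega$ (the unit circle), and $|\partial\Omega|$ its length; $\nu_0=dx/|\Omega|$ is the uniform measure. The integer $m$ always has the form $m=2L+1$ with $L\ge 0$ an integer. For an $m$-dimensional space $V_m$ of (continuous, complex-valued) functions on $\Omega$ and a probability measure $\nu$ on $\Omega$, define $$K(V_m,\nu)=\max_{x\in\Omega}\sum_{j=1}^m|L_j(x)|^2,$$ where $(L_1,\dots,L_m)$ is any basis of $V_m$ that is orthonormal in $L^2(\Omega,\nu)$ (the quantity does not depend on the choice of orthonormal basis). *)

(* Defs.v *)
From HB Require Import structures.
From mathcomp Require Import all_boot all_order all_algebra.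
From mathcomp Require Import complex.
From mathcomp Require Import all_classical all_reals all_analysis.
From mathcomp Require Import measurable_realfun.

Set Implicit Arguments.
Unset Strict Implicit.
Unset Printing Implicit Defensive.

Import Order.TTheory GRing.Theory Num.Theory.
Import numFieldNormedType.Exports.

Local Open Scope classical_set_scope.
Local Open Scope ring_scope.
Local Open Scope complex_scope.

Notation plane R := (measurableTypeR R * measurableTypeR R)%type.

Section disk.
Context {R : realType}.

Definition disk : set (plane R) := [set x | x.1 ^+ 2 + x.2 ^+ 2 <= 1].

Definition circle : set (plane R) := [set x | x.1 ^+ 2 + x.2 ^+ 2 = 1].

Lemma measurable_disk : measurable disk.
Proof.
have mf : measurable_fun [set: plane R]
    ((fun x => x.1 ^+ 2 + x.2 ^+ 2) : plane R -> R).
  by apply: measurable_funD;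
    apply: measurable_funX;
    [exact: measurable_fst|exact: measurable_snd].
rewrite (_ : disk =
    ((fun x => x.1 ^+ 2 + x.2 ^+ 2) : plane R -> R) @^-1` `]-oo, 1]).
  by rewrite -[X in measurable X]setTI; exact: mf.
by apply/seteqP; split=> x /=; rewrite in_itv.
Qed.

Definition lebesgue2 : set (plane R) -> \bar R :=
  (@lebesgue_measure R \x @lebesgue_measure R)%E.
HB.instance Definition _ := Measure.on lebesgue2.

Definition area : R := fine (lebesgue2 disk).

#[local] Hint Resolve measurable_disk : core.

Lemma lebesgue2_square (a : R) : 0 < a ->
  lebesgue2 (`[- a, a] `*` `[- a, a]) = ((a + a) ^+ 2)%:E.
Proof.
move=> a0; rewrite /lebesgue2 product_measure1E//= lebesgue_measure_itv/= lte_fin.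
by rewrite gtrN// -EFinB opprK -EFinM expr2.
Qed.

Lemma lebesgue2_disk_lty : (lebesgue2 disk < +oo)%E.
Proof.
apply: (@le_lt_trans _ _ (lebesgue2 (`[- 1, 1] `*` `[- 1, 1]))); last first.
  by rewrite lebesgue2_square// ltry.
apply: le_measure; rewrite ?inE//; first by apply: measurableX.
move=> [x y]; rewrite /disk/= => xy.
rewrite !in_itv/= -!ler_norml -(@expr_le1 _ 2 `|x|)// -(@expr_le1 _ 2 `|y|)//.
rewrite !real_normK ?num_real//; split.
  by apply: le_trans xy; rewrite lerDl sqr_ge0.
by apply: le_trans xy; rewrite lerDr sqr_ge0.
Qed.

Lemma area_gt0 : 0 < area.
Proof.
apply: fine_gt0; rewrite lebesgue2_disk_lty andbT.
apply: (@lt_le_trans _ _ (lebesgue2 (`[- 2^-1, 2^-1] `*` `[- 2^-1, 2^-1]))).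
  by rewrite lebesgue2_square// lte_fin exprn_gt0// addr_gt0.
apply: le_measure; rewrite ?inE//; first by apply: measurableX.
move=> [x y]; rewrite /disk/= !in_itv/= -!ler_norml => -[hx hy].
have H (z : R) : `|z| <= 2^-1 -> z ^+ 2 <= 2^-1.
  move=> hz; rewrite -real_normK ?num_real// expr2.
  by rewrite -[leRHS]mulr1 ler_pM// (le_trans hz)// invf_le1// ler1n.
by rewrite (le_trans (lerD (H _ hx) (H _ hy)))// -div1r -splitr.
Qed.

(* Arc length on the unit circle: the image of Lebesgue measure on [0, 2 pi]
   under the unit-speed parametrization. *)
Definition circle_param (t : measurableTypeR R) : plane R := (cos t, sin t).

Lemma measurable_circle_param :
  measurable_fun [set: measurableTypeR R] circle_param.
Proof.
apply/measurable_fun_pairP; split => /=; apply: continuous_measurable_fun.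
  exact: continuous_cos.
exact: continuous_sin.
Qed.

Definition arclength : set (plane R) -> \bar R :=
  pushforward (mrestr lebesgue_measure (measurable_itv `[0, 2 * pi]))
    circle_param.

Lemma arclength0 : arclength set0 = 0%E.
Proof. by rewrite /arclength /pushforward preimage_set0 measure0. Qed.

Lemma arclength_ge0 A : (0 <= arclength A)%E.
Proof. by rewrite /arclength /pushforward measure_ge0. Qed.

Lemma arclength_sigma_additive : semi_sigma_additive arclength.
Proof.
rewrite /arclength; apply: measure_semi_sigma_additive.
exact: measurable_circle_param.
Qed.

HB.instance Definition _ := isMeasure.Build _ _ _ arclength
  arclength0 arclength_ge0 arclength_sigma_additive.

Definition circle_length : R := fine (arclength circle).

Lemma arclengthT : arclength setT = (2 * pi)%:E.
Proof.
rewrite /arclength /pushforward preimage_setT /mrestr setTI.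
by rewrite lebesgue_measure_itv/= lte_fin mulr_gt0 ?pi_gt0// oppr0 adde0.
Qed.

Lemma arclength_circle : arclength circle = arclength setT.
Proof.
rewrite /arclength /pushforward; congr (mrestr _ _ _).
by apply/seteqP; split => // t _ /=; rewrite /circle/= cos2Dsin2.
Qed.

Lemma circle_lengthE : circle_length = 2 * pi.
Proof. by rewrite /circle_length arclength_circle arclengthT. Qed.

Lemma area_inv_ge0 : 0 <= area^-1.
Proof. by rewrite invr_ge0 ltW// area_gt0. Qed.

Lemma circle_length_inv_ge0 : 0 <= circle_length^-1.
Proof. by rewrite invr_ge0 circle_lengthE mulr_ge0// pi_ge0. Qed.

(* dx / |Omega| and dsigma / |dOmega|, extended by 0 to the whole plane *)
Definition nu_disk : set (plane R) -> \bar R :=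
  mscale (NngNum area_inv_ge0) (mrestr lebesgue2 measurable_disk).
HB.instance Definition _ := Measure.on nu_disk.

Definition nu_circle : set (plane R) -> \bar R :=
  mscale (NngNum circle_length_inv_ge0) arclength.
HB.instance Definition _ := Measure.on nu_circle.

Lemma nu_diskT : nu_disk setT = 1%E.
Proof.
rewrite /nu_disk /mscale/= /mrestr setTI -(@fineK _ (lebesgue2 disk)).
  by rewrite -EFinM mulVf// gt_eqF// area_gt0.
by rewrite ge0_fin_numE// lebesgue2_disk_lty.
Qed.

Lemma nu_circleT : nu_circle setT = 1%E.
Proof.
rewrite /nu_circle /mscale/= arclengthT circle_lengthE -EFinM mulVf//.
by rewrite mulf_neq0// gt_eqF// pi_gt0.
Qed.

Definition nu (alpha : {i01 R}) : set (plane R) -> \bar R :=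
  measure_add (mscale (1 - alpha%:num)%:nng nu_disk)
              (mscale alpha%:num%:nng nu_circle).
HB.instance Definition _ alpha := Measure.on (nu alpha).

Lemma nuT alpha : nu alpha setT = 1%E.
Proof.
rewrite /nu measure_addE.
rewrite [LHS](_ : _ = (1 - alpha%:num)%:E * nu_disk setT +
                      (alpha%:num)%:E * nu_circle setT)%E//.
by rewrite nu_diskT nu_circleT !mule1 -EFinD subrK.
Qed.

HB.instance Definition _ alpha :=
  Measure_isProbability.Build _ _ _ (nu alpha) (nuT alpha).

Lemma nu0 : nu 0%:i01 = nu_disk.
Proof.
apply/funext => A; rewrite /nu measure_addE.
rewrite [LHS](_ : _ = (1 - 0)%:E * nu_disk A + 0%:E * nu_circle A)%E//.
by rewrite subr0 mul1e mul0e adde0.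
Qed.

End disk.

Section K.
Context {R : realType}.
Implicit Types (f g : plane R -> R[i]) (V : set (plane R -> R[i])).

Definition Cintegral (P : probability (plane R) R) (D : set (plane R)) f : R[i] :=
  (\int[P]_(x in D) complex.Re (f x)) +i* (\int[P]_(x in D) complex.Im (f x)).

Definition L2_inner P f g : R[i] := Cintegral P disk (fun x => f x * (g x)^*%C).

(* Functions on the disk are represented by functions on the plane whose values
   outside the disk are irrelevant. *)
Definition Cspan m (e : 'I_m -> plane R -> R[i]) : set (plane R -> R[i]) :=
  [set f | exists c : 'I_m -> R[i],
    forall x, disk x -> f x = \sum_(j < m) c j * e j x].

Definition is_orthonormal P m (L : 'I_m -> plane R -> R[i]) :=
  forall j k, L2_inner P (L j) (L k) = (j == k)%:R.

Definition is_onb V P m (L : 'I_m -> plane R -> R[i]) :=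
  V = Cspan L /\ is_orthonormal P L.

Definition sum_sqr_norm m (L : 'I_m -> plane R -> R[i]) (x : plane R) : R :=
  \sum_(j < m) ComplexField.Normc.normc (L j x) ^+ 2.

Definition is_max (A : set R) (k : R) := A k /\ ubound A k.

Definition is_K V P (k : R) :=
  exists m (L : 'I_m -> plane R -> R[i]),
    is_onb V P L /\ is_max [set sum_sqr_norm L x | x in disk] k.

(* For V a finite-dimensional space of functions continuous on the disk,
   sum_sqr_norm L does not depend on the basis L, so is_K V P k has at most one
   solution k; the default 0 is used only if there is none. *)
Definition K V P : R := xget 0 (is_K V P).

Definition expi (t : R) : R[i] := cos t +i* sin t.

Definition wave_vector (lambda : R) (m : nat) (j : int) : R * R :=
  let t := 2 * j%:~R * pi / m%:R in (lambda * cos t, lambda * sin t).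

Definition plane_wave lambda m j : plane R -> R[i] := fun x =>
  let k := wave_vector lambda m j in expi (k.1 * x.1 + k.2 * x.2).

(* For m = 2 L + 1, the index j = i - L ranges over -L, ..., L. *)
Definition Ve (lambda : R) (m : nat) : set (plane R -> R[i]) :=
  Cspan (fun i : 'I_m => plane_wave lambda m (i%:Z - (m./2)%:Z)).

End K.

(* Main.v *)
Require Import Defs.
From mathcomp Require Import all_boot all_order all_algebra.
From mathcomp Require Import complex.
From mathcomp Require Import all_classical all_reals all_analysis.
From mathcomp Require Import measurable_realfun ring lra zify.

Set Implicit Arguments.
Unset Strict Implicit.
Unset Printing Implicit Defensive.

Import Order.TTheory GRing.Theory Num.Theory.
Import numFieldNormedType.Exports.
Local Open Scope classical_set_scope.
Local Open Scope ring_scope.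

(** Averaging the plane waves against the characters of Z/m gives the modes
  [u_l = m^-1 * \sum_j chi (- j * l) * e_j], for [l] from [- L] to [L]. They span
  the same space as the plane waves, and the rotation by [2 * pi / m] multiplies
  [u_l] by [chi (- l)]. Both the uniform measure on the disk and the arc length
  on the circle are rotation invariant, so the modes are orthogonal for every
  mixture [nu alpha] ([mode_orthogonal]). A sum of squares over an orthonormal
  basis does not depend on the basis, hence the kernel is the maximum over [x] of
  the sum of the ratios [|u_l x|^2 / ||u_l||^2] ([K_modes]).

  The exponential series shows that, up to a small relative error, [u_l] is a
  multiple of the power [|l|] of [x] as a complex number, or of its conjugate:
  [|u_l x| = A_l * r^|l| * (1 + O(r / (|l| + 1)))] with
  [A_l = (lambda / 2)^|l| / |l|!] and [r = |x|] ([fourier_mode_norm]). The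
  frequencies that the sampling by [m] points confuses with [l] exceed [|l|] in
  absolute value and contribute to the error term only.

  For the uniform measure the integral of [r^(2 l)] is at most [1 / (l + 1)]
  ([moment_le]). At a boundary point the ratio of the mode [l] is therefore at
  least [(|l| + 1) / 2] up to a constant, and summation gives quadratic growth
  ([K_uniform_ge]).

  If [alpha > 0], a mode of high frequency has squared norm at least about
  [alpha * A_l^2], coming from the circle alone, so that its ratio is at most
  [C2 / alpha] everywhere. The modes of low frequency may be small on the circle,
  but near the origin they follow their leading term, and the part
  [(1 - alpha) * dx / |Omega|] of the measure bounds their norms below uniformly
  in [m]; they contribute a constant ([K_mixed_le]). *)

(** * Rotations, translations and dilations preserve or scale the measures *)

Section invariance.
Context {R : realType}.
Local Notation leb := (@lebesgue_measure R).

Lemma lebesgue_measure_translate (a : R) (A : set (measurableTypeR R)) :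
  measurable A -> leb ((fun x => x + a) @^-1` A) = leb A.
Proof.
move=> mA.
have mf : measurable_fun setT (fun x : measurableTypeR R => x + a : measurableTypeR R).
  exact: measurable_funD.
rewrite -[LHS]/(pushforward leb (fun x : measurableTypeR R => x + a : measurableTypeR R) A).
apply/esym/lebesgue_measure_unique => //= _ [[b c]] _ <-.
rewrite /pushforward/= (_ : _ @^-1` _ = `]b - a, c - a]%classic).
  rewrite !lebesgue_measure_itv/= !lte_fin ltrD2r -!EFinB.
  by case: ifP => // _; congr EFin; ring.
by apply/seteqP; split => x /=; rewrite !in_itv/= ltrBlDr lerBrDr.
Qed.

Lemma lebesgue2E (A : set (plane R)) : measurable A ->
  lebesgue2 A = (\int[leb]_y leb (ysection A y))%E.
Proof.
move=> mA; rewrite /lebesgue2.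
apply: (@product_measure_unique _ _ _ _ R leb leb (leb \x^ leb)%E) => // B C mB mC.
exact: product_measure2E.
Qed.

(** Along each horizontal line the shear is a translation. *)
Lemma lebesgue2_shear1 (t : R) (A : set (plane R)) : measurable A ->
  lebesgue2 ((fun x : plane R => (x.1 - t * x.2, x.2) : plane R) @^-1` A) =
  lebesgue2 A.
Proof.
move=> mA.
have mf : measurable_fun setT (fun x : plane R => (x.1 - t * x.2, x.2) : plane R).
  apply/measurable_fun_pairP; split => /=; last exact: measurable_snd.
  by apply: measurable_funB => //; apply: measurable_funM => //; exact: measurable_snd.
rewrite !lebesgue2E//; last by rewrite -[X in measurable X]setTI; exact: mf.
apply: eq_integral => y _.
rewrite -[RHS](@lebesgue_measure_translate (- (t * y))); last exact: measurable_ysection.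
by congr (leb _); apply/seteqP; split => x /=; rewrite /ysection/= !inE.
Qed.

Lemma lebesgue2_shear2 (t : R) (A : set (plane R)) : measurable A ->
  lebesgue2 ((fun x : plane R => (x.1, x.2 + t * x.1) : plane R) @^-1` A) =
  lebesgue2 A.
Proof.
move=> mA.
apply: eq_integral => y _ /=.
rewrite -[RHS](@lebesgue_measure_translate (t * y)); last exact: measurable_xsection.
by congr (leb _); apply/seteqP; split => x /=; rewrite /xsection/= !inE.
Qed.

Definition rotation (theta : R) (x : plane R) : plane R :=
  (cos theta * x.1 - sin theta * x.2, sin theta * x.1 + cos theta * x.2).

Lemma measurable_rotation theta : measurable_fun setT (rotation theta).
Proof.
apply/measurable_fun_pairP; split => /=.
  by apply: measurable_funB => //; apply: measurable_funM => //;
    (exact: measurable_fst || exact: measurable_snd).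
by apply: measurable_funD => //; apply: measurable_funM => //;
  (exact: measurable_fst || exact: measurable_snd).
Qed.

(** A rotation by an angle other than [pi] (modulo [2 * pi]) is a product of three
  shears, two of them horizontal with slope [t = tan (theta / 2)]. *)
Lemma lebesgue2_rotation theta (A : set (plane R)) :
  cos theta != -1 -> measurable A ->
  lebesgue2 (rotation theta @^-1` A) = lebesgue2 A.
Proof.
move=> c1 mA; pose t := sin theta / (1 + cos theta).
have c0 : 1 + cos theta != 0 by rewrite addrC addr_eq0.
have mf : measurable_fun setT (fun x : plane R => (x.1 - t * x.2, x.2) : plane R).
  apply/measurable_fun_pairP; split => /=; last exact: measurable_snd.
  by apply: measurable_funB => //; apply: measurable_funM => //; exact: measurable_snd.
have mg : measurable_fun setT (fun x : plane R => (x.1, x.2 + sin theta * x.1) : plane R).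
  apply/measurable_fun_pairP; split => /=; first exact: measurable_fst.
  by apply: measurable_funD => //; apply: measurable_funM => //; exact: measurable_fst.
have mA1 := mf measurableT _ mA; rewrite setTI in mA1.
have mA2 := mg measurableT _ mA1; rewrite setTI in mA2.
have e1 := lebesgue2_shear1 t mA.
have e2 := lebesgue2_shear2 (sin theta) mA1.
have e3 := lebesgue2_shear1 t mA2.
rewrite -e1 -e2 -e3.
(* the half-angle identities that make the product of shears a rotation *)
have ts : t * sin theta = 1 - cos theta.
  apply: (mulIf c0); rewrite /t mulrAC divfK//.
  have := cos2Dsin2 theta; lra.
have tc : t * (1 + cos theta) = sin theta by rewrite divfK.
congr (lebesgue2 _); apply/funext => -[x y] /=; rewrite /rotation/=.
congr (A (_, _)).
- transitivity ((1 - t * sin theta) * x + (- 2 * t + t * (t * sin theta)) * y); last by ring.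
  by rewrite ts -[in LHS]tc; ring.
- transitivity (sin theta * x + (1 - t * sin theta) * y); last by ring.
  by rewrite ts; ring.
Qed.

Lemma lebesgue_itv_oc (S : set (measurableTypeR R)) (a b : R) : measurable S ->
  a <= b -> leb (S `&` `[a, b]) = leb (S `&` `]a, b]).
Proof.
move=> mS ab; rewrite -(@setU1itv _ _ (BRight b) a false) ?bnd_simp// setIUr setUC measureU0//.
- exact: measurableI.
- exact: measurableI.
- apply: (@subset_measure0 _ _ _ leb _ [set a]) => //; first exact: measurableI.
  exact: lebesgue_measure_set1.
Qed.

(** In the angular parameter the rotation is the translation by [theta]; the part
  of the parameter interval pushed beyond [2 * pi] returns to its beginning.
  Half-open intervals make the two pieces a partition. *)
Lemma arclength_rotation theta (A : set (plane R)) :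
  0 <= theta <= 2 * pi -> measurable A ->
  arclength (rotation theta @^-1` A) = arclength A.
Proof.
move=> /andP[t0 t1] mA; rewrite /arclength /pushforward /mrestr.
set S := circle_param @^-1` A.
have mS : measurable S.
  by rewrite -[S]setTI; exact: measurable_circle_param.
have SE : circle_param @^-1` (rotation theta @^-1` A) = (fun x => x + theta) @^-1` S.
  apply/seteqP; split => x /=; rewrite /S/= /circle_param /rotation/= cosD sinD.
    by move=> h; rewrite (_ : (_, _) = (cos theta * cos x - sin theta * sin x,
     sin theta * cos x + cos theta * sin x))//; congr pair; ring.
  by move=> h; rewrite (_ : (_, _) = (cos x * cos theta - sin x * sin theta,
    sin x * cos theta + cos x * sin theta))//; congr pair; ring.
have Sper x : S (x + 2 * pi) = S x.
  by rewrite /S/= /circle_param mulrDl mul1r addrA !cosDpi !sinDpi !opprK.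
have pi0 := pi_gt0 R.
rewrite SE.
have mSt : measurable ((fun x => x + theta) @^-1` S).
  have mf : measurable_fun setT (fun x : measurableTypeR R => x + theta : measurableTypeR R).
    exact: measurable_funD.
  by rewrite -[X in measurable X]setTI; exact: mf.
rewrite !lebesgue_itv_oc ?mulr_ge0 ?pi_ge0//.
rewrite (_ : _ `&` _ = (fun x => x + theta) @^-1` (S `&` `]theta, theta + 2 * pi])); last first.
  apply/seteqP; split => x /=; rewrite !in_itv/=; move=> [? /andP[? ?]]; split => //; lra.
rewrite lebesgue_measure_translate; last exact: measurableI.
have U (a b c : R) : a <= b -> b <= c -> leb (S `&` `]a, c]) =
    (leb (S `&` `]a, b]) + leb (S `&` `]b, c]))%E.
  move=> ab bc; rewrite -measureU//; [|exact: measurableI|exact: measurableI|].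
    rewrite -setIUr; congr (leb (_ `&` _)); apply/seteqP; split => x /=; rewrite !in_itv/=.
      by move=> /andP[? ?]; case: (leP x b) => ?; [left|right]; lra.
    by move=> [|] /andP[? ?]; lra.
  apply/seteqP; split => x //= [[_ ]]; rewrite !in_itv/= => /andP[? ?] [_ /andP[? ?]]; lra.
rewrite (U 0 theta (2 * pi))// (U theta (2 * pi) (theta + 2 * pi))//; last lra.
rewrite addeC; congr (_ + _)%E.
rewrite -(@lebesgue_measure_translate (2 * pi)); last exact: measurableI.
congr (leb _); apply/seteqP; split => x /=; rewrite !in_itv/= ?Sper;
  move=> [? /andP[? ?]]; split; rewrite ?Sper//; lra.
Qed.

Lemma lebesgue_measure_dilate (r : R) (A : set (measurableTypeR R)) : 0 < r ->
  measurable A -> leb A = (r%:E * leb ((fun x => (r * x)%R) @^-1` A))%E.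
Proof.
move=> r0 mA.
have mf : measurable_fun setT (fun x : measurableTypeR R => r * x : measurableTypeR R).
  exact: measurable_funM.
pose k := NngNum (ltW r0).
have e B : (r%:E * leb ((fun x => (r * x)%R) @^-1` B))%E =
   mscale k (pushforward leb (fun x : measurableTypeR R => r * x : measurableTypeR R)) B.
  by [].
rewrite e; apply: (@lebesgue_measure_unique R (mscale k (pushforward leb _))) => // _ [[b c]] _ <-.
rewrite -[RHS]/(r%:E * leb ((fun x => (r * x)%R) @^-1` `]b, c]%classic))%E.
rewrite (_ : _ @^-1` _ = `]b / r, c / r]%classic).
  rewrite !lebesgue_measure_itv/= !lte_fin ltr_pM2r ?invr_gt0// -!EFinB.
  case: ifP => // _; last by rewrite mule0.
  by rewrite -EFinM; congr EFin; field; exact: lt0r_neq0.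
by apply/seteqP; split => x /=; rewrite !in_itv/= ltr_pdivrMr// ler_pdivlMr// (mulrC x).
Qed.

Definition dilation (r : R) (x : plane R) : plane R := (r * x.1, r * x.2).

Lemma measurable_dilation r : measurable_fun setT (dilation r).
Proof.
by apply/measurable_fun_pairP; split => /=; apply: measurable_funM => //;
  (exact: measurable_fst || exact: measurable_snd).
Qed.

Lemma lebesgue2_dilation (r : R) (A : set (plane R)) : 0 < r ->
  measurable A -> lebesgue2 A = ((r ^+ 2)%:E * lebesgue2 (dilation r @^-1` A))%E.
Proof.
move=> r0 mA; pose k := NngNum (ltW (exprn_gt0 2 r0)).
have mf := measurable_dilation r.
have e B : ((r ^+ 2)%:E * lebesgue2 (dilation r @^-1` B))%E =
   mscale k (pushforward lebesgue2 (dilation r)) B by [].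
rewrite e.
apply: (@product_measure_unique _ _ _ _ R leb leb (mscale k (pushforward lebesgue2 _))) => //.
move=> B C mB mC; rewrite -[LHS]/((r ^+ 2)%:E * lebesgue2 (dilation r @^-1` (B `*` C)))%E.
have m1 (D : set (measurableTypeR R)) : measurable D ->
    measurable ((fun x => r * x) @^-1` D).
  have m : measurable_fun setT (fun x : measurableTypeR R => r * x : measurableTypeR R).
    exact: measurable_funM.
  by move=> mD; rewrite -[X in measurable X]setTI; exact: m.
rewrite (_ : _ @^-1` _ = ((fun x => r * x) @^-1` B) `*` ((fun x => r * x) @^-1` C))//.
rewrite /lebesgue2 product_measure1E; [|exact: m1|exact: m1].
rewrite [X in _ = (X * _)%E](lebesgue_measure_dilate r0)//.
rewrite [X in _ = (_ * X)%E](lebesgue_measure_dilate r0)//.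
by rewrite expr2 EFinM muleACA.
Qed.

End invariance.

(** * Rotation invariance of the mixtures and moments of the uniform measure *)

(** [pushforward mu f] bundled with its measure structure, which depends on the
  proof that [f] is measurable. *)
Definition image_measure d d' (T : measurableType d) (T' : measurableType d')
    (R : realType) (mu : {measure set T -> \bar R}) (f : T -> T')
    (mf : measurable_fun setT f) : {measure set T' -> \bar R} :=
  measure_function_pushforward__canonical__measure_function_Measure mu mf.

Section measures.
Context {R : realType}.
Implicit Types (alpha : {i01 R}) (A : set (plane R)).

Lemma nuE alpha A : nu alpha A =
  ((1 - alpha%:num)%:E * ((area^-1)%:E * lebesgue2 (A `&` disk)) +
   alpha%:num%:E * ((circle_length^-1)%:E * arclength A))%E.
Proof. by rewrite /nu measure_addE. Qed.

Definition rad2 (x : plane R) : R := x.1 ^+ 2 + x.2 ^+ 2.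

Lemma rad2_ge0 x : 0 <= rad2 x.
Proof. by rewrite addr_ge0// sqr_ge0. Qed.

Lemma measurable_rad2 : measurable_fun setT rad2.
Proof.
by apply: measurable_funD; apply: measurable_funX;
  (exact: measurable_fst || exact: measurable_snd).
Qed.

Lemma rad2_rotation theta x : rad2 (rotation theta x) = rad2 x.
Proof.
rewrite /rad2 /rotation/= -[RHS]mul1r -(cos2Dsin2 theta); ring.
Qed.

Lemma disk_rotation (theta : R) : rotation theta @^-1` disk = disk.
Proof.
by apply/funext => x; rewrite /= -[LHS]/(is_true (rad2 (rotation theta x) <= 1)) rad2_rotation.
Qed.

Lemma nu_rotation alpha theta A : cos theta != -1 -> 0 <= theta <= 2 * pi ->
  measurable A -> nu alpha (rotation theta @^-1` A) = nu alpha A.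
Proof.
move=> c1 t01 mA.
have e1 : lebesgue2 (rotation theta @^-1` A `&` disk) = lebesgue2 (A `&` disk).
  rewrite -[X in _ `&` X](disk_rotation theta) -preimage_setI.
  exact: (lebesgue2_rotation c1 (measurableI _ _ mA measurable_disk)).
have e2 := arclength_rotation t01 mA.
by rewrite (nuE alpha A) (nuE alpha (rotation theta @^-1` A)) e1 e2.
Qed.

Definition subdisk (r : R) : set (plane R) := [set x | rad2 x <= r ^+ 2].

Lemma measurable_subdisk r : measurable (subdisk r).
Proof.
rewrite (_ : subdisk r = rad2 @^-1` `]-oo, r ^+ 2]).
  by rewrite -[X in measurable X]setTI; exact: measurable_rad2.
by apply/seteqP; split=> x /=; rewrite in_itv.
Qed.

Lemma dilation_subdisk (r : R) : 0 < r -> dilation r @^-1` (subdisk r) = disk.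
Proof.
move=> r0; apply/funext => x.
rewrite -[LHS]/(is_true (rad2 (dilation r x) <= r ^+ 2)).
rewrite (_ : rad2 _ = r ^+ 2 * rad2 x); last by rewrite /rad2/=; ring.
by rewrite -[X in _ <= X]mulr1 ler_pM2l// exprn_gt0.
Qed.

Lemma rad2_dilation r x : rad2 (dilation r x) = r ^+ 2 * rad2 x.
Proof. by rewrite /rad2/=; ring. Qed.

Let moment l : \bar R := (\int[lebesgue2]_(x in disk) (rad2 x ^+ l)%:E)%E.

Let mradX l (D : set (plane R)) :
  measurable_fun D (fun x => (rad2 x ^+ l)%:E).
Proof.
by apply/measurable_EFinP; apply: measurable_funTS; apply: measurable_funX; exact: measurable_rad2.
Qed.

Let radX_ge0 l x : (0 <= (rad2 x ^+ l)%:E)%E.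
Proof. by rewrite lee_fin exprn_ge0// rad2_ge0. Qed.

(** [rad2 ^+ l] is homogeneous of degree [2 * l], and dilations scale area
  quadratically. *)
Lemma moment_subdisk l (r : R) : 0 < r ->
  (\int[lebesgue2]_(x in subdisk r) (rad2 x ^+ l)%:E =
   ((r ^+ 2) ^+ l.+1)%:E * moment l)%E.
Proof.
move=> r0; pose k := NngNum (ltW (exprn_gt0 2 r0)).
have mf := @measurable_dilation R r.
have mk : measurable (dilation r @^-1` subdisk r).
  by rewrite dilation_subdisk//; exact: measurable_disk.
transitivity (\int[mscale k (image_measure lebesgue2 mf)]_(x in subdisk r) (rad2 x ^+ l)%:E)%E.
  apply: eq_measure_integral => A mA _.
  transitivity ((r ^+ 2)%:E * lebesgue2 (dilation r @^-1` A))%E; last by [].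
  by rewrite -(lebesgue2_dilation r0 mA).
have mS := measurable_subdisk r.
have e1 := @ge0_integral_mscale _ _ _ (image_measure lebesgue2 mf) _ mS k _
  (@mradX l (subdisk r)) (fun x _ => @radX_ge0 l x).
rewrite {}e1.
have e2 := @ge0_integral_pushforward _ _ _ _ _ _ mf lebesgue2 _ _ mS
  (@mradX l (subdisk r)) (fun x _ => @radX_ge0 l x).
rewrite -/(image_measure lebesgue2 mf) in e2.
rewrite {}e2.
rewrite dilation_subdisk//= /moment.
under eq_integral do rewrite /= rad2_dilation exprMn EFinM.
rewrite ge0_integralZl//; last 2 first.
- exact: measurable_disk.
- by rewrite lee_fin exprn_ge0// exprn_ge0// ltW.
by rewrite -[k%:num]/(r ^+ 2) muleA -EFinM -exprS.
Qed.

Lemma areaE : lebesgue2 (@disk R) = area%:E.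
Proof. by rewrite /area fineK// ge0_fin_numE// lebesgue2_disk_lty. Qed.

Lemma measure_subdisk (r : R) : 0 < r -> lebesgue2 (subdisk r) = ((r ^+ 2) * area)%:E.
Proof.
move=> r0; rewrite (lebesgue2_dilation r0); last exact: measurable_subdisk.
by rewrite dilation_subdisk// EFinM areaE.
Qed.

(** Outside the subdisk the integrand is at most 1. *)
Lemma moment_split l (r : R) : 0 < r < 1 ->
  (moment l <= ((r ^+ 2) ^+ l.+1)%:E * moment l + ((1 - r ^+ 2) * area)%:E)%E.
Proof.
move=> /andP[r0 r1]; rewrite -moment_subdisk// /moment.
have sub : subdisk r `<=` disk.
  by move=> x /=; rewrite /subdisk/= => /le_trans; apply; rewrite expr_le1// ltW.
have mD := @measurable_disk R; have mS := measurable_subdisk r.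
rewrite -{1}(setDUK sub) ge0_integral_setU//; last 2 first.
- exact: measurableD.
- by apply/disj_setPS => x [? []].
apply: leeD2l.
apply: (@le_trans _ _ (\int[lebesgue2]_(x in disk `\` subdisk r) (cst 1%:E x))%E).
  apply: ge0_le_integral => //.
  - exact: measurableD.
  - move=> x [h _]; rewrite lee_fin exprn_ile1//; exact: rad2_ge0.
rewrite integral_cst ?mul1e; last exact: measurableD.
rewrite measureD//; last by rewrite lebesgue2_disk_lty.
rewrite -[leLHS]/(lebesgue2 disk - lebesgue2 (disk `&` subdisk r))%E.
by rewrite (setIidr sub) measure_subdisk// areaE -EFinB mulrBl mul1r.
Qed.

Lemma moment_le_area l : (moment l <= area%:E)%E.
Proof.
have mD := @measurable_disk R.
rewrite -areaE -[leRHS]mul1e -integral_cst//.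
apply: ge0_le_integral => //.
move=> x h; rewrite lee_fin exprn_ile1//; exact: rad2_ge0.
Qed.

(** With [q = r ^+ 2], splitting the disk at radius [r] gives
  [moment * (1 - q ^+ l.+1) <= (1 - q) * area]. Division by [1 - q] turns this
  into [moment * (1 + q + ... + q ^+ l) <= area], and [q] tends to 1. *)
Lemma moment_le l : (moment l <= (area / l.+1%:R)%:E)%E.
Proof.
have := moment_le_area l; have : (0 <= moment l)%E by exact: integral_ge0.
have := @moment_split l; case: (moment l) => // I H.
rewrite !lee_fin => I0 Ia; rewrite ler_pdivlMr ?ltr0n//.
have a0 := @area_gt0 R.
have K (q : R) : 0 < q < 1 -> I * (l.+1%:R * q ^+ l) <= area.
  move=> /andP[q0 q1].
  have s0 : 0 < Num.sqrt q < 1.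
    by rewrite sqrtr_gt0 q0/= -sqrtr1 ltr_sqrt.
  have := H _ s0; rewrite sqr_sqrtr ?(ltW q0)// -EFinM -EFinD lee_fin.
  have : 1 - q ^+ l.+1 = (1 - q) * \sum_(i < l.+1) q ^+ i.
    by rewrite -opprB subrX1 -mulNr opprB.
  have : l.+1%:R * q ^+ l <= \sum_(i < l.+1) q ^+ i.
    rewrite mulr_natl -[X in _ *+ X]card_ord -sumr_const ler_sum// => i _.
    by rewrite ler_wiXn2l ?ltW// -ltnS.
  set S := \sum_(i < l.+1) _; set T := _ * q ^+ l => TS E1 E2.
  have E3 : (1 - q) * (I * S) <= (1 - q) * area.
    by rewrite mulrCA -E1; lra.
  have q1' : 0 < 1 - q by rewrite subr_gt0.
  rewrite ler_pM2l// in E3; apply: le_trans E3; exact: ler_wpM2l.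
apply/ler_addgt0Pr => e e0.
(* [q = 1 - d], with [d] so small that replacing [q ^+ l] by 1 costs at most [e],
   by Bernoulli's inequality *)
pose N : R := area * l.+1%:R * l%:R + 1.
have N0 : 1 <= N by rewrite lerDr !mulr_ge0// ltW.
pose d : R := Num.min (1 / 2) (e / N).
have d0 : 0 < d by rewrite lt_min divr_gt0//= divr_gt0// (lt_le_trans _ N0).
have d1 : d <= 1 / 2 by rewrite ge_min lexx.
have d2 : d <= e / N by rewrite ge_min lexx orbT.
have /K : 0 < 1 - d < 1 by lra.
have B : 1 - l%:R * d <= (1 - d) ^+ l.
  elim: (l) => [|n IH]; first by rewrite mul0r subr0 expr0.
  rewrite exprS; apply: (@le_trans _ _ ((1 - d) * (1 - n%:R * d))).
    rewrite -natr1; have : 0 <= n%:R * d ^+ 2 by rewrite mulr_ge0// sqr_ge0.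
    lra.
  by rewrite ler_wpM2l//; lra.
move=> H1; have H2 : I * l.+1%:R * (1 - l%:R * d) <= area.
  apply: le_trans H1; rewrite -mulrA; apply: ler_wpM2l => //.
  exact: ler_wpM2l.
suff : I * l.+1%:R * (l%:R * d) <= e by lra.
apply: (@le_trans _ _ (N * d)); last by rewrite mulrC -ler_pdivlMr// (lt_le_trans _ N0).
rewrite mulrA; apply: ler_wpM2r; first exact: ltW.
rewrite /N; apply: (@le_trans _ _ (area * l.+1%:R * l%:R)); last by rewrite lerDl.
by rewrite ler_wpM2r// ler_wpM2r.
Qed.

End measures.

(** * Complex numbers and tame functions *)

Section complex_numbers.
Local Open Scope complex_scope.
Context {R : realType}.
Implicit Types z w : R[i].
Local Notation normc := ComplexField.Normc.normc.
Local Notation Re := complex.Re.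
Local Notation Im := complex.Im.

Lemma ReD z w : Re (z + w) = Re z + Re w. Proof. by case: z w => [a b] [c d]. Qed.
Lemma ImD z w : Im (z + w) = Im z + Im w. Proof. by case: z w => [a b] [c d]. Qed.
Lemma ReM z w : Re (z * w) = Re z * Re w - Im z * Im w.
Proof. by case: z w => [a b] [c d]. Qed.
Lemma ImM z w : Im (z * w) = Re z * Im w + Im z * Re w.
Proof. by case: z w => [a b] [c d]. Qed.
Lemma ReJ z : Re z^*%C = Re z. Proof. by case: z. Qed.
Lemma ImJ z : Im z^*%C = - Im z. Proof. by case: z. Qed.

Lemma Re_sum I (r : seq I) (F : I -> R[i]) :
  Re (\sum_(i <- r) F i) = \sum_(i <- r) Re (F i).
Proof. by elim/big_ind2 : _ => // x1 x2 y1 y2 <- <-; rewrite ReD. Qed.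

Lemma Im_sum I (r : seq I) (F : I -> R[i]) :
  Im (\sum_(i <- r) F i) = \sum_(i <- r) Im (F i).
Proof. by elim/big_ind2 : _ => // x1 x2 y1 y2 <- <-; rewrite ImD. Qed.

Lemma conjc_sum I (r : seq I) (F : I -> R[i]) :
  (\sum_(i <- r) F i)^*%C = \sum_(i <- r) (F i)^*%C.
Proof. exact: (rmorph_sum (@conjc R)). Qed.

Lemma conjcM z w : (z * w)^*%C = z^*%C * w^*%C.
Proof. exact: (rmorphM (@conjc R)). Qed.

Lemma normc2E z : normc z ^+ 2 = Re z ^+ 2 + Im z ^+ 2.
Proof. by case: z => a b /=; rewrite sqr_sqrtr// addr_ge0// sqr_ge0. Qed.

Lemma mulcJ z : z * z^*%C = (normc z ^+ 2)%:C.
Proof.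
by rewrite normc2E; case: z => a b; apply/eqP; rewrite eq_complex /=;
  apply/andP; split; apply/eqP; ring.
Qed.

Lemma normc_ge0 z : 0 <= normc z. Proof. by case: z => a b; exact: sqrtr_ge0. Qed.

Lemma normcR (x : R) : normc x%:C = `|x|.
Proof. by rewrite /= expr0n/= addr0 sqrtr_sqr. Qed.

Lemma normcX z n : normc (z ^+ n) = normc z ^+ n.
Proof.
elim: n => [|n IH]; first by rewrite !expr0 ComplexField.Normc.normc1.
by rewrite !exprS ComplexField.Normc.normcM IH.
Qed.

Lemma normc_conj z : normc z^*%C = normc z.
Proof. by case: z => a b /=; rewrite sqrrN. Qed.

Lemma normc_sum I (r : seq I) (F : I -> R[i]) :
  normc (\sum_(i <- r) F i) <= \sum_(i <- r) normc (F i).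
Proof.
elim/big_ind2 : _ => //; first by rewrite ComplexField.Normc.normc0.
by move=> x1 x2 y1 y2 h1 h2; apply: le_trans (le_normcD _ _) _; exact: lerD.
Qed.

Lemma normc_le_ReIm z : normc z <= `|Re z| + `|Im z|.
Proof.
rewrite -(ler_pXn2r (_ : 0 < 2)%N)// ?nnegrE ?normc_ge0 ?addr_ge0//.
rewrite normc2E -(real_normK (num_real (Re z))) -(real_normK (num_real (Im z))).
have : 0 <= `|Re z| * `|Im z| by exact: mulr_ge0.
by rewrite sqrrD; lra.
Qed.

Lemma expiD (s t : R) : expi (s + t) = expi s * expi t.
Proof.
apply/eqP; rewrite eq_complex /expi /= cosD sinD eqxx/=.
by apply/eqP; ring.
Qed.

Lemma expi0 : expi 0 = 1 :> R[i].
Proof. by rewrite /expi cos0 sin0. Qed.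

Lemma expiJ (t : R) : (expi t)^*%C = expi (- t).
Proof. by rewrite /expi/= cosN sinN. Qed.

Lemma normc_expi (t : R) : normc (expi t) = 1.
Proof. by rewrite /= cos2Dsin2 sqrtr1. Qed.

End complex_numbers.

Section tame_functions.
Local Open Scope complex_scope.
Context {R : realType}.
Implicit Types f g : plane R -> R.

(** Measurability and boundedness on the disk make a function integrable for every
  probability measure; continuity makes it attain its maximum on the disk. *)
Definition tame f := [/\ measurable_fun setT f,
  continuous (f : (R * R)%type -> R) &
  exists M : R, forall x, disk x -> `|f x| <= M].

Lemma tame_cst (a : R) : tame (fun=> a).
Proof.
split; [exact: measurable_cst | by move=> x; exact: cvg_cst | by exists `|a|].
Qed.

Lemma tameD f g : tame f -> tame g -> tame (fun x => f x + g x).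
Proof.
move=> [mf cf [M hM]] [mg cg [N hN]]; split; first exact: measurable_funD.
  by move=> x; apply: cvgD; [exact: cf | exact: cg].
exists (M + N) => x dx; apply: le_trans (ler_normD _ _) _.
by apply: lerD; [exact: hM | exact: hN].
Qed.

Lemma tameM f g : tame f -> tame g -> tame (fun x => f x * g x).
Proof.
move=> [mf cf [M hM]] [mg cg [N hN]]; split; first exact: measurable_funM.
  by move=> x; apply: cvgM; [exact: cf | exact: cg].
by exists (M * N) => x dx; rewrite normrM ler_pM ?hM ?hN.
Qed.

Lemma tameN f : tame f -> tame (fun x => - f x).
Proof.
move=> tf; rewrite (_ : (fun _ => _) = (fun x => -1 * f x)); last first.
  by apply/funext => x; rewrite mulN1r.
exact: tameM (tame_cst _) tf.
Qed.

Lemma tame_sum I (r : seq I) (F : I -> plane R -> R) :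
  (forall i, tame (F i)) -> tame (fun x => \sum_(i <- r) F i x).
Proof.
move=> tF; elim: r => [|i r IH].
  rewrite (_ : (fun _ => _) = (fun=> 0)); first exact: tame_cst.
  by apply/funext => x; rewrite big_nil.
rewrite (_ : (fun _ => _) = (fun x => F i x + \sum_(j <- r) F j x)).
  exact: tameD.
by apply/funext => x; rewrite big_cons.
Qed.

Lemma tame_lin_comp (h : R -> R) (a b M : R) : continuous h ->
  (forall t, `|h t| <= M) -> tame (fun x => h (a * x.1 + b * x.2)).
Proof.
move=> ch hM; split; last by exists M => x _; exact: hM.
- apply: measurableT_comp; first exact: continuous_measurable_fun.
  by apply: measurable_funD; apply: measurable_funM => //;
    (exact: measurable_fst || exact: measurable_snd).
- move=> x.
  apply: (@continuous_comp (R * R)%type R R (fun x => a * x.1 + b * x.2) h); last exact: ch.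
  by apply: cvgD; apply: cvgM; (exact: cvg_cst || exact: cvg_fst || exact: cvg_snd).
Qed.

Lemma tame_integrable (P : probability (plane R) R) f :
  tame f -> P.-integrable disk (EFin \o f).
Proof.
move=> [mf _ [M hM]]; apply: measurable_bounded_integrable.
- exact: measurable_disk.
- by rewrite -ge0_fin_numE// fin_num_measure//; exact: measurable_disk.
- exact: measurable_funTS.
- exists M; split; first exact: num_real.
  by move=> y My x /= dx; apply: le_trans (hM _ dx) (ltW My).
Qed.

End tame_functions.

(** * The inner product and the kernel in an orthonormal basis *)

Section inner_product.
Local Open Scope complex_scope.
Context {R : realType} (P : probability (plane R) R).
Implicit Types f g : plane R -> R[i].
Local Notation normc := ComplexField.Normc.normc.
Local Notation Re := complex.Re.
Local Notation Im := complex.Im.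

Definition ctame f := tame (fun x => Re (f x)) /\ tame (fun x => Im (f x)).

Lemma ctame_cst (c : R[i]) : ctame (fun=> c).
Proof. by split; exact: tame_cst. Qed.

Lemma ctameM f g : ctame f -> ctame g -> ctame (fun x => f x * g x).
Proof.
move=> [rf jf] [rg jg]; split.
  under eq_fun do rewrite ReM.
  by apply: tameD; [exact: tameM | apply: tameN; exact: tameM].
under eq_fun do rewrite ImM.
by apply: tameD; exact: tameM.
Qed.

Lemma ctame_sum n (F : 'I_n -> plane R -> R[i]) :
  (forall i, ctame (F i)) -> ctame (fun x => \sum_(i < n) F i x).
Proof.
move=> tF; split.
  under eq_fun do rewrite Re_sum.
  by apply: tame_sum => i; case: (tF i).
under eq_fun do rewrite Im_sum.
by apply: tame_sum => i; case: (tF i).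
Qed.

Lemma ctameJ f : ctame f -> ctame (fun x => (f x)^*%C).
Proof.
move=> [rf jf]; split.
  by under eq_fun do rewrite ReJ.
by under eq_fun do rewrite ImJ; exact: tameN.
Qed.

Lemma ctame_lincomb n (c : 'I_n -> R[i]) (F : 'I_n -> plane R -> R[i]) :
  (forall i, ctame (F i)) -> ctame (fun x => \sum_(i < n) c i * F i x).
Proof.
by move=> tF; apply: ctame_sum => i; exact: ctameM (ctame_cst _) (tF i).
Qed.

Lemma eq_L2_inner f f' g g' : (forall x, disk x -> f x = f' x) ->
  (forall x, disk x -> g x = g' x) -> L2_inner P f g = L2_inner P f' g'.
Proof.
move=> ff gg; rewrite /L2_inner /Cintegral; congr (_ +i* _);
  by apply: eq_Rintegral => x; rewrite inE => dx; rewrite ff// gg.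
Qed.

Lemma CintegralD f g : ctame f -> ctame g ->
  Cintegral P disk (fun x => f x + g x) = Cintegral P disk f + Cintegral P disk g.
Proof.
move=> [rf jf] [rg jg]; rewrite /Cintegral.
under eq_Rintegral do rewrite ReD.
rewrite RintegralD//; [|exact: measurable_disk|exact: tame_integrable..].
under [in X in _ +i* X]eq_Rintegral do rewrite ImD.
by rewrite RintegralD//; [exact: measurable_disk|exact: tame_integrable..].
Qed.

Lemma CintegralZ (c : R[i]) f : ctame f ->
  Cintegral P disk (fun x => c * f x) = c * Cintegral P disk f.
Proof.
move=> [rf jf]; rewrite /Cintegral.
have mD := @measurable_disk R.
have Z (a : R) h : tame h -> \int[P]_(x in disk) (a * h x) = a * \int[P]_(x in disk) h x.
  by move=> th; rewrite RintegralZl//; exact: tame_integrable.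
have tZ (a : R) h : tame h -> tame (fun x => a * h x) by exact: tameM (tame_cst _).
under eq_Rintegral do rewrite ReM -mulNr.
rewrite RintegralD//; [|by apply: tame_integrable; exact: tZ..].
under [in X in _ +i* X]eq_Rintegral do rewrite ImM.
rewrite RintegralD//; [|by apply: tame_integrable; exact: tZ..].
rewrite !Z//; apply/eqP; rewrite eq_complex; case: c => a b /=.
by rewrite mulNr !eqxx.
Qed.

Lemma Cintegral_sum n (F : 'I_n -> plane R -> R[i]) : (forall i, ctame (F i)) ->
  Cintegral P disk (fun x => \sum_(i < n) F i x) =
  \sum_(i < n) Cintegral P disk (F i).
Proof.
elim: n F => [|n IH] F tF.
  rewrite big_ord0; transitivity (0 * Cintegral P disk (fun=> 0)); last exact: mul0r.
  rewrite -CintegralZ; last exact: ctame_cst.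
  by congr Cintegral; apply/funext => x; rewrite big_ord0 mul0r.
rewrite big_ord_recr/= -IH// -CintegralD//; last exact: ctame_sum.
by congr Cintegral; apply/funext => x; rewrite big_ord_recr.
Qed.

Lemma L2_inner_suml n (c : 'I_n -> R[i]) (F : 'I_n -> plane R -> R[i]) g :
  (forall i, ctame (F i)) -> ctame g ->
  L2_inner P (fun x => \sum_(i < n) c i * F i x) g =
  \sum_(i < n) c i * L2_inner P (F i) g.
Proof.
move=> tF tg; rewrite /L2_inner.
have tJ := ctameJ tg.
transitivity (Cintegral P disk (fun x => \sum_(i < n) c i * (F i x * (g x)^*%C))).
  by congr Cintegral; apply/funext => x; rewrite mulr_suml;
    apply: eq_bigr => i _; rewrite mulrA.
rewrite Cintegral_sum; last first.
  by move=> i; apply: ctameM (ctame_cst _) _; exact: ctameM.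
by apply: eq_bigr => i _; rewrite CintegralZ//; exact: ctameM.
Qed.

Lemma L2_innerC f g : ctame f -> ctame g -> L2_inner P f g = (L2_inner P g f)^*%C.
Proof.
move=> tf tg; rewrite /L2_inner.
have [rh jh] := ctameM tg (ctameJ tf).
rewrite {2}/Cintegral/=; congr (_ +i* _).
  by apply: eq_Rintegral => x _; rewrite !ReM !ReJ !ImJ; ring.
rewrite -mulN1r -RintegralZl//; [|exact: measurable_disk|exact: tame_integrable].
by apply: eq_Rintegral => x _; rewrite !ImM !ReJ !ImJ; ring.
Qed.

Lemma L2_inner_norm2 f : ctame f ->
  L2_inner P f f = (\int[P]_(x in disk) (normc (f x) ^+ 2))%:C.
Proof.
move=> tf; rewrite /L2_inner /Cintegral; congr (_ +i* _).
  by apply: eq_Rintegral => x _; rewrite mulcJ.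
rewrite (@eq_Rintegral _ _ _ _ _ (fun=> 0)); last by move=> x _; rewrite mulcJ.
by rewrite Rintegral_cst ?mul0r//; exact: measurable_disk.
Qed.

Lemma sum_sqr_normE n (L : 'I_n -> plane R -> R[i]) x :
  (sum_sqr_norm L x)%:C = \sum_(i < n) L i x * (L i x)^*%C.
Proof.
rewrite /sum_sqr_norm (rmorph_sum (real_complex R)); apply: eq_bigr => i _.
by rewrite mulcJ.
Qed.

Lemma orthonormal_coef n (w : 'I_n -> plane R -> R[i]) (c : 'I_n -> R[i]) f j :
  (forall i, ctame (w i)) -> is_orthonormal P w ->
  (forall x, disk x -> f x = \sum_(i < n) c i * w i x) ->
  L2_inner P f (w j) = c j.
Proof.
move=> tw ow fE; rewrite (eq_L2_inner (f' := fun x => \sum_(i < n) c i * w i x)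
  (g' := w j))// L2_inner_suml// (bigD1 j)//= ow eqxx mulr1 big1 ?addr0// => i ij.
by rewrite ow (negbTE ij) mulr0.
Qed.

Lemma Cspan_mem n (F : 'I_n -> plane R -> R[i]) i : Cspan F (F i).
Proof.
exists (fun j => (j == i)%:R) => y _; rewrite (bigD1 i)//= eqxx mul1r big1 ?addr0//.
by move=> j ji; rewrite (negbTE ji) mul0r.
Qed.

(** Expanding each basis in the other, the two transition matrices are adjoint. *)
Lemma sum_sqr_norm_tame p q (L : 'I_p -> plane R -> R[i])
    (w : 'I_q -> plane R -> R[i]) x :
  (forall i, ctame (L i)) -> (forall j, ctame (w j)) ->
  is_orthonormal P L -> is_orthonormal P w -> Cspan L = Cspan w -> disk x ->
  sum_sqr_norm L x = sum_sqr_norm w x.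
Proof.
move=> tL tw oL ow LwE dx.
have Lw i y : disk y -> L i y = \sum_(j < q) L2_inner P (L i) (w j) * w j y.
  have [c cE] : Cspan w (L i) by rewrite -LwE; exact: Cspan_mem.
  by move=> dy; rewrite cE//; apply: eq_bigr => j _; rewrite (orthonormal_coef j tw ow cE).
have wL j y : disk y -> w j y = \sum_(i < p) L2_inner P (w j) (L i) * L i y.
  have [c cE] : Cspan L (w j) by rewrite LwE; exact: Cspan_mem.
  by move=> dy; rewrite cE//; apply: eq_bigr => i _; rewrite (orthonormal_coef i tL oL cE).
apply: (@complexI R); rewrite !sum_sqr_normE.
under eq_bigr do rewrite {1}Lw// mulr_suml.
rewrite exchange_big/=; apply: eq_bigr => j _.
rewrite [X in _ = _ * X^*%C](wL j x dx) conjc_sum mulr_sumr.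
by apply: eq_bigr => i _; rewrite conjcM -L2_innerC// [RHS]mulrCA mulrA.
Qed.

(** Members of an arbitrary basis are constrained only on the disk; replacing each
  by the equal combination of the tame functions [w] makes it tame everywhere. *)
Lemma sum_sqr_norm_unique p q (L : 'I_p -> plane R -> R[i])
    (w : 'I_q -> plane R -> R[i]) x :
  (forall j, ctame (w j)) -> is_orthonormal P L -> is_orthonormal P w ->
  Cspan L = Cspan w -> disk x -> sum_sqr_norm L x = sum_sqr_norm w x.
Proof.
move=> tw oL ow LwE dx.
have /choice[a aE] : forall i, exists a : 'I_q -> R[i],
    forall y, disk y -> L i y = \sum_(j < q) a j * w j y.
  by move=> i; have : Cspan w (L i) by rewrite -LwE; exact: Cspan_mem.
pose L' i y := \sum_(j < q) a i j * w j y.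
have LL' i y : disk y -> L i y = L' i y by exact: aE.
have tL' i : ctame (L' i) by exact: ctame_lincomb.
rewrite -(sum_sqr_norm_tame tL' tw _ ow _ dx).
- by apply: eq_bigr => i _; rewrite LL'.
- by move=> i j; rewrite -oL; apply: eq_L2_inner => y dy; rewrite LL'.
- rewrite -LwE; apply/seteqP; split => f [c cE]; exists c => y dy; rewrite cE//;
  by apply: eq_bigr => i _; rewrite LL'.
Qed.

End inner_product.

Section christoffel.
Local Open Scope complex_scope.
Context {R : realType}.

Lemma compact_disk : compact (disk : set (R * R)%type).
Proof.
apply: (@subclosed_compact _ (disk : set (R * R)%type) (`[-1, 1] `*` `[-1, 1])).
- rewrite (_ : disk = (fun x : (R * R)%type => x.1 ^+ 2 + x.2 ^+ 2) @^-1` [set y | y <= 1])//.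
  apply: closed_comp; last exact: closed_le.
  move=> x _; apply: cvgD; apply: cvgM; (exact: cvg_fst || exact: cvg_snd).
- by apply: compact_setX; exact: segment_compact.
- move=> [x y]; rewrite /disk/= !in_itv/= => h.
  have hx : x ^+ 2 <= 1 by have := sqr_ge0 y; lra.
  have hy : y ^+ 2 <= 1 by have := sqr_ge0 x; lra.
  by rewrite -!ler_norml -sqrtr_sqr -[X in _ <= X](sqrtr1) ler_wsqrtr// -sqrtr_sqr
     -[X in _ <= X]sqrtr1 ler_wsqrtr.
Qed.

(** The sum of squares is independent of the orthonormal basis and continuous on a
  compact set, so the kernel is a genuine maximum rather than a default value,
  and any tame orthonormal basis computes it. *)
Lemma K_orthonormal_basis (P : probability (plane R) R) V m (w : 'I_m -> plane R -> R[i]) :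
  (forall j, ctame (w j)) -> is_onb V P w ->
  exists x : plane R, [/\ disk x, K V P = sum_sqr_norm w x &
    forall y, disk y -> sum_sqr_norm w y <= K V P].
Proof.
move=> tw [VE ow].
have : {within (disk : set (R * R)%type), continuous (sum_sqr_norm w : (R * R)%type -> R)}.
  apply: continuous_subspaceT.
  have : tame (sum_sqr_norm w).
    apply: tame_sum => j; have [rw jw] := tw j.
    under eq_fun do rewrite normc2E !expr2.
    by apply: tameD; exact: tameM.
  by case.
have ne : (disk : set (R * R)%type) !=set0.
  by exists (0, 0); rewrite /disk/= !expr0n/= addr0.
move/(compact_EVT_max ne compact_disk) => [x xD xmax].
rewrite inE in xD.
have Kx : is_K V P (sum_sqr_norm w x).
  exists m, w; split; first by split.
  by split; [exists x|move=> _ [y dy <-]; apply: xmax; rewrite inE].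
have -> : K V P = sum_sqr_norm w x.
  apply: xget_unique => //.
  move=> k [n [L [[VL oL] [[z dz zk] km]]]].
  have e y : disk y -> sum_sqr_norm L y = sum_sqr_norm w y.
    by apply: (@sum_sqr_norm_unique _ P) => //; rewrite -VL.
  apply/eqP; rewrite eq_le; apply/andP; split; first by rewrite -zk e// xmax ?inE.
  by apply: km; exists x => //; rewrite e.
by exists x; split => // y dy; apply: xmax; rewrite inE.
Qed.

End christoffel.

(** * Truncated exponential series *)

Section exponential_sums.
Local Open Scope complex_scope.
Context {R : realType}.
Local Notation normc := ComplexField.Normc.normc.
Local Notation Re := complex.Re.
Local Notation Im := complex.Im.

(** The induction goes by steps of two, since multiplication by [(i t) ^+ 2]
  preserves the parity of the exponent. *)
Lemma Re_Im_imaginaryX (t : R) n :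
  Re ((0 +i* t) ^+ n) = (~~ odd n)%:R * (-1) ^+ n./2 * t ^+ n /\
  Im ((0 +i* t) ^+ n) = (odd n)%:R * (-1) ^+ n.-1./2 * t ^+ n.
Proof.
suff : forall k, (k <= 1)%N -> forall h n, n = (h.*2 + k)%N ->
  Re ((0 +i* t) ^+ n) = (~~ odd n)%:R * (-1) ^+ n./2 * t ^+ n /\
  Im ((0 +i* t) ^+ n) = (odd n)%:R * (-1) ^+ n.-1./2 * t ^+ n.
  move=> H; apply: (H (odd n) _ n./2); first by case: (odd n).
  by rewrite addnC odd_double_half.
move=> k k1; elim => [|h IH] {}n ->.
  by case: k k1 => [|[|//]] _; rewrite !(expr0, expr1)/=; split; rewrite ?expr0 ?expr1; ring.
have [IH1 IH2] := IH _ erefl.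
rewrite doubleS !addSn; set q := (h.*2 + k)%N in IH1 IH2 *.
rewrite !exprS /= !negbK.
have [e1 e2] : Re ((0 +i* t) * ((0 +i* t) * (0 +i* t) ^+ q)) = - (t ^+ 2) * Re ((0 +i* t) ^+ q)
   /\ Im ((0 +i* t) * ((0 +i* t) * (0 +i* t) ^+ q)) = - (t ^+ 2) * Im ((0 +i* t) ^+ q).
  by rewrite !ReM !ImM !ReM/=; split; ring.
rewrite e1 e2 IH1 IH2; split; first by ring.
case: q {IH1 IH2 e1 e2 IH} => [|q]/=; first by ring.
by rewrite !exprS; ring.
Qed.

Definition exp_sum N (z : R[i]) : R[i] := \sum_(n < N) z ^+ n / n`!%:R.

Lemma natfact_complex n : n`!%:R^-1 = (n`!%:R^-1)%:C :> R[i].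
Proof. by rewrite fmorphV rmorph_nat. Qed.

(** The real and imaginary parts of the partial sums are those of the series that
  define [cos] and [sin]. *)
Lemma exp_sum_cvg (t e : R) : 0 < e ->
  \forall N \near \oo, normc (expi t - exp_sum N (0 +i* t)) <= e.
Proof.
move=> e0.
have hc : series (cos_coeff t) @ \oo --> cos t.
  by rewrite unlock; exact: is_cvg_series_cos_coeff.
have hs : series (sin_coeff t) @ \oo --> sin t.
  by rewrite unlock; exact: is_cvg_series_sin_coeff.
have e2 : 0 < e / 2 by rewrite divr_gt0.
have hc' := (@cvgrPdist_le _ _ _ _ _ _ _).1 hc _ e2.
have hs' := (@cvgrPdist_le _ _ _ _ _ _ _).1 hs _ e2.
near=> N.
apply: le_trans (normc_le_ReIm _) _; rewrite [e]splitr; apply: lerD.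
- rewrite ReD (_ : Re (- _) = - series (cos_coeff t) N).
    by near: N; exact: hc'.
  rewrite /series/= big_mkord /exp_sum; case: (\sum_(n < N) _) (Re_sum (index_enum 'I_N) (fun n : 'I_N => (0 +i* t) ^+ n / n`!%:R)) => a b /= ->.
  congr (- _); apply: eq_bigr => n _; rewrite natfact_complex ReM/= mulr0 subr0.
  by rewrite (Re_Im_imaginaryX t n).1 /cos_coeff/= exprnP.
- rewrite ImD (_ : Im (- _) = - series (sin_coeff t) N).
    by near: N; exact: hs'.
  rewrite /series/= big_mkord /exp_sum; case: (\sum_(n < N) _) (Im_sum (index_enum 'I_N) (fun n : 'I_N => (0 +i* t) ^+ n / n`!%:R)) => a b /= ->.
  congr (- _); apply: eq_bigr => n _; rewrite natfact_complex ImM/= mulr0 add0r.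
  by rewrite (Re_Im_imaginaryX t n).2 /sin_coeff/=.
Unshelve. all: by end_near. Qed.

Lemma exp_sum_le (s : R) N : 0 <= s -> \sum_(n < N) s ^+ n / n`!%:R <= expR s.
Proof.
move=> s0.
have nd : nondecreasing_seq (series (exp_coeff s)).
  apply/nondecreasing_seqP => n; rewrite /series/= big_nat_recr//= lerDl.
  by rewrite /exp_coeff/= divr_ge0// exprn_ge0.
have := nondecreasing_cvgn_le nd (is_cvg_series_exp_coeff s) N.
by rewrite /series/= big_mkord.
Qed.

(** Bounding [p`!] below by [l.+1`! * (p - l.+1)`!] turns the tail into a full
  binomial sum while keeping the factor [1 / l.+1`!], on which the comparison of
  a mode with its leading term rests. *)
Lemma binomial_tail l n n' : n = (l.+1 + n')%N ->
  \sum_(p < n.+1 | (l < p)%N) (p`!%:R * (n - p)`!%:R)^-1 <=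
  2 ^+ n' / (l.+1`!%:R * n'`!%:R) :> R.
Proof.
move=> nE.
have -> : \sum_(p < n.+1 | (l < p)%N) (p`!%:R * (n - p)`!%:R)^-1 =
    \sum_(p < n'.+1) ((l.+1 + p)`!%:R * (n' - p)`!%:R)^-1 :> R.
  rewrite -(big_mkord (fun p => l < p)%N (fun p => (p`!%:R * (n - p)`!%:R)^-1)).
  rewrite (@big_cat_nat _ _ _ l.+1)//=; last by rewrite nE -addnS leq_addr.
  rewrite [X in X + _]big1_seq ?add0r; last first.
    by move=> p /andP[lp]; rewrite mem_index_iota => /andP[_]; rewrite ltnS leqNgt lp.
  rewrite -[X in index_iota X _]add0n big_addn nE -addnS addKn big_mkord.
  apply: eq_big => [p|p _]; first by rewrite addnC leq_addr.
  by rewrite addnC subnDl.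
have fact_neq0 k : k`!%:R != 0 :> R by rewrite pnatr_eq0 -lt0n fact_gt0.
have -> : 2 ^+ n' / (l.+1`!%:R * n'`!%:R) =
    \sum_(p < n'.+1) (l.+1`!%:R * (p`!%:R * (n' - p)`!%:R))^-1 :> R.
  rewrite -[2]/(1 + 1) exprDn mulr_suml; apply: eq_bigr => p _.
  have pn : (p <= n')%N by rewrite -ltnS.
  have E : 'C(n', p)%:R * (p`!%:R * (n' - p)`!%:R) = n'`!%:R :> R.
    by rewrite -!natrM bin_fact.
  rewrite -E.
  have b0 : 'C(n', p)%:R != 0 :> R by rewrite pnatr_eq0 -lt0n bin_gt0.
  have aux (c u v w : R) : c != 0 -> u != 0 -> v != 0 -> w != 0 ->
      c / (u * (c * (v * w))) = (u * (v * w))^-1.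
    by move=> c0 u0 v0 w0; field; rewrite c0 u0 v0 w0.
  by rewrite !expr1n mulr1 aux.
apply: ler_sum => p _; rewrite lef_pV2 ?posrE -?natrM ?ltr0n ?muln_gt0 ?fact_gt0//.
rewrite ler_nat mulnA leq_mul2r; apply/orP; right.
rewrite -(@bin_fact (l.+1 + p) p) ?leq_addl// addnK.
by rewrite [X in (_ <= _ * X)%N]mulnC leq_pmull// bin_gt0 leq_addl.
Qed.

End exponential_sums.

(** * Fourier coefficients of a plane wave on equidistributed points *)

(** A plane wave is [exp (a * z + b / z)] with [z] on the unit circle. Averaged
  over [m] equidistributed points [z j] against [z ^- l], the monomial
  [z ^+ p * z ^- q] survives only if [p - q = l] modulo [m], which for
  [p, q <= l] leaves the leading term [a ^+ l / l`!]. *)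
Section fourier_coefficient.
Local Open Scope complex_scope.
Context {R : realType}.
Local Notation normc := ComplexField.Normc.normc.
Variables (m : nat) (z : 'I_m -> R[i]) (a b : R[i]) (s : R) (l : nat).
Hypotheses (m0 : (0 < m)%N) (z1 : forall j, normc (z j) = 1).
Hypotheses (na : normc a <= s) (nb : normc b <= s).
Hypothesis zl : forall p q, (p <= l)%N -> (q <= l)%N ->
  \sum_(j < m) (z j)^*%C ^+ l * ((z j)^*%C ^+ q * z j ^+ p) =
  ((p == l) && (q == 0))%:R * m%:R.

(** The average of [z ^+ (p - q - l)]. *)
Let g p q := m%:R^-1 * \sum_(j < m) (z j)^*%C ^+ l * ((z j)^*%C ^+ q * z j ^+ p).

(** The part of the average that has degree [n] in [a] and [b]. *)
Let T n := \sum_(p < n.+1)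
  (p`!%:R * (n - p)`!%:R)^-1 * (b ^+ (n - p) * a ^+ p) * g p (n - p).

Let mC : m%:R != 0 :> R[i].
Proof. by rewrite pnatr_eq0 -lt0n. Qed.

Let g_le1 p q : normc (g p q) <= 1.
Proof.
rewrite /g ComplexField.Normc.normcM ComplexField.Normc.normcV.
rewrite -(rmorph_nat (real_complex R)) normcR normr_nat mulrC ler_pdivrMr ?ltr0n// mul1r.
apply: le_trans (normc_sum _ _) _.
under eq_bigr do rewrite !ComplexField.Normc.normcM !normcX normc_conj z1 !expr1n !mulr1.
by rewrite sumr_const card_ord.
Qed.

Let gE p q : (p <= l)%N -> (q <= l)%N -> g p q = ((p == l) && (q == 0))%:R.
Proof. by move=> pl ql; rewrite /g zl// mulrC mulfK. Qed.

Let sumT N : m%:R^-1 * \sum_(j < m) (z j)^*%C ^+ l * exp_sum N (a * z j + b * (z j)^*%C) =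
  \sum_(n < N) T n.
Proof.
transitivity (\sum_(n < N) \sum_(p < n.+1) m%:R^-1 * \sum_(j < m)
    (z j)^*%C ^+ l * ((p`!%:R * (n - p)`!%:R)^-1 *
     ((b ^+ (n - p) * a ^+ p) * ((z j)^*%C ^+ (n - p) * z j ^+ p)))); last first.
  apply: eq_bigr => n _; apply: eq_bigr => p _; rewrite /g mulrCA; congr (_ * _).
  have aux (c w x d : R[i]) : c * (w * (x * d)) = (w * x) * (c * d) by ring.
  by rewrite mulr_sumr; apply: eq_bigr => j _; rewrite aux.
under [RHS]eq_bigr do rewrite -mulr_sumr exchange_big/=.
rewrite -mulr_sumr exchange_big/=; congr (_ * _); apply: eq_bigr => j _.
rewrite /exp_sum mulr_sumr; apply: eq_bigr => n _; rewrite -mulr_sumr; congr (_ * _).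
rewrite addrC exprDn mulr_suml; apply: eq_bigr => p _.
have pn : (p <= n)%N by rewrite -ltnS.
have E : 'C(n, p)%:R * (p`!%:R * (n - p)`!%:R) = n`!%:R :> R[i].
  by rewrite -!natrM bin_fact.
have c0 : 'C(n, p)%:R != 0 :> R[i] by rewrite pnatr_eq0 -lt0n bin_gt0.
rewrite -mulr_natl -E invfM mulrACA divff// mul1r !exprMn.
by rewrite mulrC mulrACA.
Qed.

Let T_lt n : (n < l)%N -> T n = 0.
Proof.
move=> nl; rewrite /T big1// => p _; rewrite gE.
- by rewrite (@ltn_eqF p l) ?mulr0// (leq_ltn_trans _ nl)// -ltnS.
- by rewrite ltnW// (leq_ltn_trans _ nl)// -ltnS.
- by rewrite ltnW// (leq_ltn_trans _ nl)// leq_subr.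
Qed.

Let T_eq : T l = a ^+ l / l`!%:R.
Proof.
rewrite /T big_ord_recr/= subnn big1 ?add0r.
  by rewrite gE// !eqxx !expr0 mul1r fact0 mulr1 mulr1 mulrC.
move=> p _; rewrite gE ?leq_subr//; last exact: ltnW.
by rewrite ltn_eqF// mulr0.
Qed.

Let s0 : 0 <= s. Proof. exact: le_trans (normc_ge0 _) na. Qed.

(** Beyond degree [l], only terms with [p > l] or [n - p > l] survive, and both
  groups are binomial tails. *)
Let T_gt n' : let n := (l.+1 + n')%N in
  (normc (T n) <= 2 * s ^+ n * (2 ^+ n' / (l.+1`!%:R * n'`!%:R))).
Proof.
set n := (l.+1 + n')%N.
pose w p : R := (p`!%:R * (n - p)`!%:R)^-1.
have w0 p : 0 <= w p by rewrite invr_ge0 mulr_ge0.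
apply: (@le_trans _ _ (\sum_(p < n.+1)
    s ^+ n * ((l < p)%:R * w p + (l < n - p)%:R * w p))).
  apply: le_trans (normc_sum _ _) _; apply: ler_sum => p _.
  have pn : (p <= n)%N by rewrite -ltnS.
  have -> : normc ((p`!%:R * (n - p)`!%:R)^-1 * (b ^+ (n - p) * a ^+ p) * g p (n - p))
    = w p * (normc b ^+ (n - p) * normc a ^+ p) * normc (g p (n - p)).
    rewrite !ComplexField.Normc.normcM !normcX; congr (_ * _ * _).
    by rewrite ComplexField.Normc.normcV -natrM -(rmorph_nat (real_complex R)) normcR normr_nat natrM.
  have sn : normc b ^+ (n - p) * normc a ^+ p <= s ^+ n.
    have -> : s ^+ n = s ^+ (n - p) * s ^+ p by rewrite -exprD subnK.
    by apply: ler_pM; rewrite ?exprn_ge0 ?normc_ge0//; apply: lerXn2r;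
      rewrite ?nnegrE ?normc_ge0.
  have [lp|pl] := ltnP l p; last have [lq|ql] := ltnP l (n - p).
  - apply: (@le_trans _ _ (w p * s ^+ n * 1)).
      by rewrite ler_pM ?normc_ge0 ?mulr_ge0 ?exprn_ge0 ?normc_ge0// ler_wpM2l.
    rewrite mulr1 mulrC ler_wpM2l ?exprn_ge0// mul1r lerDl.
    by rewrite mulr_ge0.
  - apply: (@le_trans _ _ (w p * s ^+ n * 1)).
      by rewrite ler_pM ?normc_ge0 ?mulr_ge0 ?exprn_ge0 ?normc_ge0// ler_wpM2l.
    by rewrite mulr1 mulrC ler_wpM2l ?exprn_ge0// mul0r mul1r add0r.
  - rewrite gE// (_ : _ && _ = false) ?ComplexField.Normc.normc0 ?mulr0; last first.
      by apply/negP => /andP[/eqP e1 /eqP e2]; move: e2; rewrite /n e1; lia.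
    by rewrite !mul0r addr0 mulr0.
rewrite -mulr_sumr [2 * _]mulrC -mulrA ler_wpM2l ?exprn_ge0//.
have tail := binomial_tail (erefl n : n = (l.+1 + n')%N) : _ <= _ :> R.
have e1 : \sum_(p < n.+1) (l < p)%:R * w p = \sum_(p < n.+1 | (l < p)%N) w p.
  rewrite [RHS]big_mkcond/=; apply: eq_bigr => p _.
  by case: ifP => _; rewrite ?mul1r ?mul0r.
have e2 : \sum_(p < n.+1) (l < n - p)%:R * w p = \sum_(p < n.+1) (l < p)%:R * w p.
  rewrite (reindex_inj rev_ord_inj)/=; apply: eq_bigr => p _.
  have pn : (p <= n)%N by rewrite -ltnS.
  by rewrite subSS subKn// /w subKn// [X in X^-1]mulrC.
by rewrite big_split/= e2 e1 mulrDl mul1r lerD.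
Qed.

Lemma fourier_coefficient_estimate N : (l < N)%N ->
  normc (m%:R^-1 * \sum_(j < m) (z j)^*%C ^+ l * exp_sum N (a * z j + b * (z j)^*%C)
     - a ^+ l / l`!%:R) <= 2 * s ^+ l.+1 / l.+1`!%:R * expR (2 * s).
Proof.
move=> lN; rewrite sumT -T_eq -(subnK lN) addnC big_split_ord/= big_ord_recr/=.
rewrite big1 ?add0r; last by move=> n _; exact: T_lt.
rewrite addrAC subrr add0r; apply: le_trans (normc_sum _ _) _.
apply: (@le_trans _ _ (\sum_(i < N - l.+1)
    2 * s ^+ l.+1 / l.+1`!%:R * ((2 * s) ^+ i / i`!%:R))).
  apply: ler_sum => i _; apply: le_trans (T_gt i) _.
  rewrite le_eqVlt; apply/orP; left; apply/eqP.
  by rewrite exprD exprMn invfM; ring.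
rewrite -mulr_sumr; apply: ler_wpM2l; last by apply: exp_sum_le; rewrite mulr_ge0.
by rewrite divr_ge0// mulr_ge0// exprn_ge0.
Qed.

End fourier_coefficient.

(** * Discrete Fourier modes *)

(** For [m = 2 L + 1], the index set [{- L, ..., L}] as a shift of ['I_m]. *)
Definition centered m (i : 'I_m) : int := i%:Z - (m./2)%:Z.

Lemma centered_inj m : injective (@centered m).
Proof. by move=> i j /addIr [] /val_inj. Qed.

Lemma centered_lt m (i j : 'I_m) : (`|centered i - centered j| < m)%N.
Proof. by have := ltn_ord i; have := ltn_ord j; rewrite /centered; lia. Qed.

Lemma centered_small m (k : 'I_m) : odd m -> ((absz (centered k)).*2 < m)%N.
Proof.
move=> om; have := ltn_ord k; have := odd_double_half m; rewrite om /centered; lia.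
Qed.

Lemma sum_centered (R : realType) m (F : nat -> R) : odd m ->
  \sum_(k < m) F (absz (centered k)) =
  \sum_(i < m./2) F i.+1 + \sum_(i < m./2.+1) F i.
Proof.
move=> om; rewrite /centered; set L := m./2.
have mL : m = (L + L.+1)%N by have := odd_double_half m; rewrite om -/L; lia.
rewrite -(big_mkord xpredT (fun k => F (absz (k%:Z - L%:Z)))) {1}mL.
rewrite (@big_cat_nat _ _ _ L)//=; last by rewrite leq_addr.
congr (_ + _).
  rewrite big_mkord (reindex_inj rev_ord_inj)/=; apply: eq_bigr => i _.
  by congr F; have := ltn_ord i; lia.
rewrite -[X in index_iota X _]add0n big_addn addKn big_mkord.
by apply: eq_bigr => i _; congr F; lia.
Qed.

Section roots_of_unity.
Local Open Scope complex_scope.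
Context {R : realType} (m : nat).
Hypothesis m0 : (0 < m)%N.
Local Notation normc := ComplexField.Normc.normc.
Implicit Types d : int.

Let mR : m%:R != 0 :> R. Proof. by rewrite pnatr_eq0 -lt0n. Qed.
Let mC : m%:R != 0 :> R[i]. Proof. by rewrite pnatr_eq0 -lt0n. Qed.

Definition angle d : R := 2 * d%:~R * pi / m%:R.
Definition chi d : R[i] := expi (angle d).

Lemma angleD d e : angle (d + e) = angle d + angle e.
Proof. by rewrite /angle intrD; ring. Qed.

Lemma angleN d : angle (- d) = - angle d.
Proof. by rewrite /angle intrN mulrN !mulNr. Qed.

Lemma chiD d e : chi (d + e) = chi d * chi e.
Proof. by rewrite /chi angleD expiD. Qed.

Lemma chi0 : chi 0 = 1.
Proof. by rewrite /chi /angle mulr0 !mul0r expi0. Qed.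

Lemma chiJ d : (chi d)^*%C = chi (- d).
Proof. by rewrite /chi expiJ angleN. Qed.

Lemma normc_chi d : normc (chi d) = 1.
Proof. exact: normc_expi. Qed.

Lemma chiX d n : chi d ^+ n = chi (d * n%:Z).
Proof.
elim: n => [|n IH]; first by rewrite expr0 mulr0 chi0.
by rewrite exprS IH -chiD intS mulrDr mulr1.
Qed.

Lemma angle_m : angle m%:Z = 2 * pi.
Proof. by rewrite /angle -pmulrn; field. Qed.

Lemma chi_m d : chi (d * m%:Z) = 1.
Proof.
have chim : chi m%:Z = 1.
  by rewrite /chi angle_m mulrDl mul1r /expi cosDpi sinDpi cospi sinpi oppr0 opprK.
have chin (n : nat) : chi (n%:Z * m%:Z) = 1 by rewrite mulrC -chiX chim expr1n.
case: d => n; first exact: chin.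
by rewrite NegzE mulNr -chiJ chin; rewrite /= oppr0.
Qed.

(** If [chi d = 1], then [1 - 2 * sin (angle d / 2) ^+ 2 = 1], although for [d > 0]
  the half angle lies strictly between 0 and [pi]. *)
Lemma chi_neq1 d : (0 < `|d| < m)%N -> chi d != 1.
Proof.
wlog : d / exists n : nat, d = n%:Z.
  move=> H; case: d => n; first by apply: H; exists n.
  rewrite NegzE abszN => h; rewrite -chiJ; apply: contra (H _ _ h); last by exists n.+1.
  by move=> /eqP/(congr1 (@conjc R)); rewrite conjcK => ->; apply/eqP; rewrite /= oppr0.
move=> [n ->] /= /andP[n0 nm]; apply/negP => /eqP /(congr1 (@complex.Re R)) /=.
have a0 : 0 < angle n%:Z / 2 < pi.
  have -> : angle n%:Z / 2 = n%:R / m%:R * pi by rewrite /angle -pmulrn; field.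
  rewrite pmulr_lgt0 ?pi_gt0// divr_gt0 ?ltr0n//= -[ltRHS]mul1r ltr_pM2r ?pi_gt0//.
  by rewrite ltr_pdivrMr ?ltr0n// mul1r ltr_nat.
have s0 := sin_gt0_pi a0; rewrite [angle _]splitr cosD -!expr2 => c1.
have := cos2Dsin2 (angle n%:Z / 2); have : 0 < sin (angle n%:Z / 2) ^+ 2 by exact: exprn_gt0.
lra.
Qed.

Lemma sum_chi d : (`|d| < m)%N ->
  \sum_(i < m) chi (centered i * d) = (d == 0)%:R * m%:R.
Proof.
move=> dm; have [->|d0] := eqVneq d 0.
  under eq_bigr do rewrite mulr0 chi0.
  by rewrite sumr_const card_ord mul1r.
rewrite mul0r.
have -> : \sum_(i < m) chi (centered i * d) =
    chi (- (m./2)%:Z * d) * \sum_(i < m) chi d ^+ i.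
  rewrite mulr_sumr; apply: eq_bigr => i _.
  by rewrite chiX -chiD /centered; congr chi; ring.
apply/eqP; rewrite mulf_eq0; apply/orP; right.
have : chi d ^+ m - 1 = 0 by rewrite chiX chi_m subrr.
rewrite subrX1 => /eqP; rewrite mulf_eq0 subr_eq0 (negbTE (chi_neq1 _))//.
by rewrite absz_gt0 d0.
Qed.

(** By periodicity the term that leaves the window at one end reenters at the other. *)
Lemma sum_shift (F : int -> R[i]) (c : int) : (forall d, F (d + m%:Z) = F d) ->
  \sum_(i < m) F (i%:Z - c - 1) = \sum_(i < m) F (i%:Z - c).
Proof.
move=> FP; case: m FP m0 => // n FP _.
rewrite big_ord_recl big_ord_recr/= [LHS]addrC; congr (_ + _).
  by apply: eq_bigr => i _; congr F; rewrite /bump /= add1n intS; ring.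
by rewrite -FP; congr F; rewrite intS; ring.
Qed.

End roots_of_unity.

Section plane_waves.
Local Open Scope complex_scope.
Context {R : realType} (lambda : R) (m : nat).
Hypothesis m0 : (0 < m)%N.
Implicit Types (d : int) (x : plane R).
Local Notation centered := (@centered m).
Local Notation chi := (@chi R m).
Local Notation angle := (@angle R m).

Let mC : m%:R != 0 :> R[i]. Proof. by rewrite pnatr_eq0 -lt0n. Qed.

(** The discrete Fourier transform of the plane waves. As [m] grows it tends,
  up to a constant of modulus 1, to the Fourier-Bessel mode of angular frequency
  [- l]. *)
Definition fourier_mode (l : int) x : R[i] :=
  m%:R^-1 * \sum_(i < m) chi (- (centered i * l)) * plane_wave lambda m (centered i) x.

Lemma plane_wave_fourier (i : 'I_m) x :
  plane_wave lambda m (centered i) x =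
  \sum_(k < m) chi (centered i * centered k) * fourier_mode (centered k) x.
Proof.
rewrite /fourier_mode.
transitivity (m%:R^-1 * \sum_(j < m) \sum_(k < m)
    chi (centered k * (centered i - centered j)) * plane_wave lambda m (centered j) x); last first.
  rewrite exchange_big/= mulr_sumr; apply: eq_bigr => k _.
  rewrite [RHS]mulrCA; congr (_ * _); rewrite mulr_sumr; apply: eq_bigr => j _.
  by rewrite mulrA -chiD; congr (chi _ * _); ring.
rewrite (eq_bigr (fun j => (i == j)%:R * m%:R * plane_wave lambda m (centered j) x)).
  rewrite (bigD1 i)//= eqxx mul1r big1 ?addr0; first by rewrite mulKf.
  by move=> j ji; rewrite eq_sym (negbTE ji) !mul0r.
move=> j _; rewrite -mulr_suml (sum_chi m0) ?subr_eq0 ?(inj_eq (@centered_inj m))//.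
exact: centered_lt.
Qed.

Lemma plane_wave_rotation d x :
  plane_wave lambda m d (rotation (angle 1) x) = plane_wave lambda m (d - 1) x.
Proof.
rewrite /plane_wave /wave_vector/= -!/(angle _) angleD angleN cosB sinB.
by congr expi; ring.
Qed.

Lemma plane_wave_period d x :
  plane_wave lambda m (d + m%:Z) x = plane_wave lambda m d x.
Proof.
rewrite /plane_wave /wave_vector/= -!/(angle _) angleD (angle_m m0).
by rewrite mulrDl mul1r addrA !cosDpi !sinDpi !opprK.
Qed.

(** Rotation by [2 * pi / m] permutes the plane waves cyclically, so the modes are
  its eigenvectors; frequencies distinct modulo [m] have distinct eigenvalues. *)
Lemma fourier_mode_rotation l x :
  fourier_mode l (rotation (angle 1) x) = chi (- l) * fourier_mode l x.
Proof.
rewrite /fourier_mode mulrCA; congr (_ * _); rewrite mulr_sumr.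
pose F d := chi (- (d * l)) * plane_wave lambda m d x.
transitivity (\sum_(i < m) chi (- l) * F (i%:Z - (m./2)%:Z - 1)).
  apply: eq_bigr => i _; rewrite plane_wave_rotation mulrA -chiD.
  by congr (chi _ * _); rewrite /centered; ring.
rewrite -!mulr_sumr; congr (_ * _); rewrite (@sum_shift _ m m0 F)// => d.
rewrite /F plane_wave_period.
rewrite (_ : - ((d + m%:Z) * l) = - (d * l) + (- l) * m%:Z); last by ring.
by rewrite chiD (chi_m m0) mulr1.
Qed.

Lemma ctame_plane_wave d : ctame (plane_wave lambda m d).
Proof.
split; apply: (@tame_lin_comp _ _ _ _ 1).
- exact: continuous_cos.
- by move=> t; rewrite ler_norml cos_geN1 cos_le1.
- exact: continuous_sin.
- by move=> t; rewrite ler_norml sin_geN1 sin_le1.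
Qed.

Lemma ctame_fourier_mode l : ctame (fourier_mode l).
Proof.
apply: ctameM; first exact: ctame_cst.
by apply: ctame_lincomb => i; exact: ctame_plane_wave.
Qed.

End plane_waves.

(** * Pointwise size of the modes *)

Section mode_estimates.
Local Open Scope complex_scope.
Context {R : realType} (lambda : R) (m : nat).
Hypotheses (lambda0 : 0 < lambda) (m0 : (0 < m)%N).
Local Notation normc := ComplexField.Normc.normc.
Local Notation centered := (@centered m).
Local Notation chi := (@chi R m).
Local Notation mode := (@fourier_mode R lambda m).

Let mR : m%:R != 0 :> R. Proof. by rewrite pnatr_eq0 -lt0n. Qed.

Definition radius (x : plane R) : R := Num.sqrt (rad2 x).

Let phase (x : plane R) (j : 'I_m) : R :=
  let k := wave_vector lambda m (centered j) in k.1 * x.1 + k.2 * x.2.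

(** Bounds uniform in the length of the truncated exponentials pass to the plane
  waves. *)
Let mode_limit l x (w : R[i]) (B : R) n :
  (forall N, (n < N)%N ->
     normc (m%:R^-1 * \sum_(j < m) chi (- (centered j * l)) * exp_sum N (0 +i* phase x j) - w) <= B) ->
  normc (mode l x - w) <= B.
Proof.
move=> H; apply/ler_addgt0Pr => e e0.
have : \forall N \near \oo, forall j : 'I_m,
    normc (expi (phase x j) - exp_sum N (0 +i* phase x j)) <= e.
  by apply: filter_forall => j; exact: exp_sum_cvg.
move=> nearN.
have [N [nN HN]] : exists N, (n < N)%N /\ forall j : 'I_m,
    normc (expi (phase x j) - exp_sum N (0 +i* phase x j)) <= e.
  have [N _ HN] : \forall N \near \oo, (n < N)%N /\ forall j : 'I_m,
      normc (expi (phase x j) - exp_sum N (0 +i* phase x j)) <= e.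
    by apply: filterI => //; exact: nbhs_infty_gt.
  by exists N; apply: HN => /=.
rewrite -(subrK (m%:R^-1 * \sum_(j < m) chi (- (centered j * l)) * exp_sum N (0 +i* phase x j)) (mode l x)).
rewrite -addrA addrC; apply: le_trans (le_normcD _ _) _; apply: lerD; first exact: H.
rewrite /fourier_mode -mulrBr -sumrB ComplexField.Normc.normcM ComplexField.Normc.normcV.
rewrite -(rmorph_nat (real_complex R)) normcR normr_nat mulrC ler_pdivrMr ?ltr0n//.
apply: le_trans (normc_sum _ _) _.
rewrite mulr_natr -[X in _ *+ X]card_ord -sumr_const; apply: ler_sum => j _.
by rewrite -mulrBr ComplexField.Normc.normcM normc_chi mul1r HN.
Qed.

(** The leading term [w] is a multiple of a power of the conjugate of [x], seen as
  a complex number, or of [x] itself when [l] is negative: in that case the roles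
  of [z] and [z ^-1] are exchanged. *)
Lemma fourier_mode_estimate l x : ((absz l).*2 < m)%N -> exists2 w : R[i],
  normc w = (lambda / 2) ^+ (absz l) / (absz l)`!%:R * radius x ^+ (absz l) &
  normc (mode l x - w) <= 2 * (lambda / 2 * radius x) ^+ (absz l).+1 / (absz l).+1`!%:R
     * expR (2 * (lambda / 2 * radius x)).
Proof.
move=> lm.
have key (z : 'I_m -> R[i]) (a b : R[i]) :
    normc a = lambda / 2 * radius x -> normc b = lambda / 2 * radius x ->
    (forall j, normc (z j) = 1) ->
    (forall j, 0 +i* phase x j = a * z j + b * (z j)^*%C) ->
    (forall j, (z j)^*%C ^+ (absz l) = chi (- (centered j * l))) ->
    (forall p q, (p <= absz l)%N -> (q <= absz l)%N ->
       \sum_(j < m) (z j)^*%C ^+ (absz l) * ((z j)^*%C ^+ q * z j ^+ p) =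
      ((p == (absz l)) && (q == 0))%:R * m%:R) ->
  exists2 w : R[i],
  normc w = (lambda / 2) ^+ (absz l) / (absz l)`!%:R * radius x ^+ (absz l) &
  normc (mode l x - w) <= 2 * (lambda / 2 * radius x) ^+ (absz l).+1 / (absz l).+1`!%:R
     * expR (2 * (lambda / 2 * radius x)).
  move=> na nb z1 tE zc zs; exists (a ^+ (absz l) / (absz l)`!%:R).
    rewrite ComplexField.Normc.normcM normcX na exprMn mulrAC; congr (_ * _ * _).
    by rewrite ComplexField.Normc.normcV -(rmorph_nat (real_complex R)) normcR normr_nat.
  apply: (@mode_limit _ _ _ _ (absz l)) => N lN.
  under eq_bigr do rewrite -zc tE.
  by apply: fourier_coefficient_estimate => //; rewrite ?na ?nb.
have norm_ab (e : R) : e ^+ 2 = 1 ->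
    normc ((lambda / 2 * (e * x.2)) +i* (lambda / 2 * x.1)) = lambda / 2 * radius x.
  move=> e1 /=; rewrite /radius.
  have -> : (lambda / 2 * (e * x.2)) ^+ 2 + (lambda / 2 * x.1) ^+ 2 =
     (lambda / 2) ^+ 2 * rad2 x.
    rewrite /rad2 !exprMn e1; ring.
  by rewrite sqrtrM ?sqr_ge0// sqrtr_sqr ger0_norm// divr_ge0// ltW.
case: l lm key => n lm key.
- apply: (key (fun j => chi (centered j)) ((lambda / 2 * (1 * x.2)) +i* (lambda / 2 * x.1))
     ((lambda / 2 * (-1 * x.2)) +i* (lambda / 2 * x.1))).
  + by apply: norm_ab; rewrite expr1n.
  + by apply: norm_ab; rewrite sqrrN expr1n.
  + by move=> j; exact: normc_chi.
  + move=> j; rewrite /phase /wave_vector/= -!/(angle _ _).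
    by apply/eqP; rewrite eq_complex/=; apply/andP; split; apply/eqP; field.
  + by move=> j; rewrite chiJ chiX mulNr.
  + move=> p q pl ql.
    transitivity (\sum_(j < m) chi (centered j * (p%:Z - q%:Z - n%:Z))).
      by apply: eq_bigr => j _; rewrite !chiJ !chiX -!chiD; congr chi; ring.
    rewrite sum_chi//; last by move: lm pl ql => /=; lia.
    by congr (_%:R * _); congr nat_of_bool; move: pl ql => /=; lia.
- apply: (key (fun j => chi (- centered j)) ((lambda / 2 * (-1 * x.2)) +i* (lambda / 2 * x.1))
     ((lambda / 2 * (1 * x.2)) +i* (lambda / 2 * x.1))).
  + by apply: norm_ab; rewrite sqrrN expr1n.
  + by apply: norm_ab; rewrite expr1n.
  + by move=> j; exact: normc_chi.
  + move=> j; rewrite /phase /wave_vector -!/(angle _ _) /chi angleN /expi cosN sinN /=.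
    by apply/eqP; rewrite eq_complex/=; apply/andP; split; apply/eqP; field.
  + by move=> j; rewrite chiJ chiX NegzE opprK mulrN opprK.
  + move=> p q pl ql.
    transitivity (\sum_(j < m) chi (centered j * (q%:Z + n.+1%:Z - p%:Z))).
      by apply: eq_bigr => j _; rewrite !chiJ !chiX -!chiD; congr chi;
         rewrite /=; ring.
    rewrite sum_chi//; last by move: lm pl ql => /=; lia.
    by congr (_%:R * _); congr nat_of_bool; move: pl ql => /=; lia.
Qed.

(** The coefficient of [r ^+ n] in the Bessel function [J_n (lambda * r)]. *)
Definition amplitude (n : nat) : R := (lambda / 2) ^+ n / n`!%:R.
Definition distortion : R := lambda * expR lambda.

Lemma amplitude_gt0 n : 0 < amplitude n.
Proof. by rewrite divr_gt0 ?exprn_gt0 ?divr_gt0// ltr0n fact_gt0. Qed.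

Lemma distortion_gt0 : 0 < distortion.
Proof. by rewrite mulr_gt0// expR_gt0. Qed.

Lemma radius_ge0 x : 0 <= radius x. Proof. exact: sqrtr_ge0. Qed.

Lemma radius2 x : radius x ^+ 2 = rad2 x.
Proof. by rewrite sqr_sqrtr// rad2_ge0. Qed.

Lemma radius_le1 x : disk x -> radius x <= 1.
Proof. by move=> dx; rewrite -sqrtr1 ler_wsqrtr. Qed.

(** The relative error decays both in the frequency, which gives the growth of the
  kernel, and in the radius, which bounds the norm of low modes from below. *)
Lemma fourier_mode_norm l x : ((absz l).*2 < m)%N -> disk x ->
  `|normc (mode l x) - amplitude (absz l) * radius x ^+ (absz l) | <=
  amplitude (absz l) * radius x ^+ (absz l) * (distortion * radius x / (absz l).+1%:R).
Proof.
move=> lm dx; have [w nw h] := fourier_mode_estimate x lm.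
rewrite -/(amplitude _) in nw; rewrite -nw.
have h2 : `|normc (mode l x) - normc w| <= normc (mode l x - w).
  rewrite ler_norml lerBlDr lerNl opprB lerBlDr; apply/andP; split.
    rewrite -[mode l x - w]opprB normcN -[X in normc X <= _](subrK (mode l x)).
    exact: le_normcD.
  by rewrite -[X in normc X <= _](subrK w); exact: le_normcD.
apply: le_trans h2 (le_trans h _).
rewrite nw /amplitude /distortion.
have r0 := radius_ge0 x; have r1 := radius_le1 dx.
set r := radius x in r0 r1 *; set n := (absz l).
have -> : 2 * (lambda / 2 * r) ^+ n.+1 / n.+1`!%:R * expR (2 * (lambda / 2 * r)) =
   (lambda / 2) ^+ n / n`!%:R * r ^+ n * (lambda * expR (2 * (lambda / 2 * r)) * r / n.+1%:R).
  have aux (g rn f k E : R) : f != 0 -> k != 0 ->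
      2 * (lambda / 2 * g * (r * rn)) / (k * f) * E = g / f * rn * (lambda * E * r / k).
    by move=> f0 k0; field; rewrite f0 k0.
  rewrite factS natrM exprMn !exprS aux// pnatr_eq0 -lt0n//.
have l0 := ltW lambda0.
apply: ler_wpM2l; first by rewrite mulr_ge0 ?exprn_ge0// ltW// amplitude_gt0.
apply: ler_wpM2r; first by rewrite invr_ge0.
apply: ler_wpM2r => //; apply: ler_wpM2l => //; rewrite ler_expR.
have -> : 2 * (lambda / 2 * r) = lambda * r by field.
by rewrite -[leRHS]mulr1 ler_wpM2l.
Qed.

End mode_estimates.

(** * Orthogonality and lower bounds for the norms *)

Section mode_geometry.
Local Open Scope complex_scope.
Context {R : realType} (lambda : R) (m : nat) (alpha : {i01 R}).
Hypotheses (lambda0 : 0 < lambda) (m2 : (2 < m)%N).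
Local Notation normc := ComplexField.Normc.normc.
Local Notation mode := (@fourier_mode R lambda m).
Local Notation A := (amplitude lambda).
Local Notation D := (distortion lambda).

Let m0 : (0 < m)%N. Proof. exact: ltn_trans m2. Qed.
Let mR0 : 0 < m%:R :> R. Proof. by rewrite ltr0n. Qed.

Lemma Rintegral_rotation (theta : R) (f : plane R -> R) :
  cos theta != -1 -> 0 <= theta <= 2 * pi -> tame f ->
  \int[nu alpha]_(x in disk) f (rotation theta x) = \int[nu alpha]_(x in disk) f x.
Proof.
move=> c1 t01 [mf _ [M hM]].
have mD := @measurable_disk R; have mr := @measurable_rotation R theta.
rewrite /Rintegral; congr fine.
have mE : measurable_fun setT (EFin \o f) by exact/measurable_EFinP.
have intf : (nu alpha).-integrable (rotation theta @^-1` disk)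
    ((EFin \o f) \o rotation theta).
  rewrite disk_rotation.
  apply: (@measurable_bounded_integrable _ _ _ _ (f \o rotation theta)) => //.
  - by rewrite -ge0_fin_numE// fin_num_measure.
  - apply: measurable_funTS; exact: measurableT_comp.
  - exists M; split; first exact: num_real.
    move=> y My x /= dx; apply: le_trans (ltW My); apply: hM.
    by rewrite -[disk _]/((rotation theta @^-1` disk) x) disk_rotation.
have := @integral_pushforward _ _ _ _ _ _ mr (nu alpha) disk _ mE intf mD.
rewrite disk_rotation => <-.
apply: eq_measure_integral => B mB _.
by rewrite -[LHS]/(nu alpha (rotation theta @^-1` B)) nu_rotation.
Qed.

Let angle01 : 0 <= (angle m 1 : R) <= 2 * pi.
Proof.
rewrite /angle mulr1; apply/andP; split.
  by rewrite divr_ge0// mulr_ge0// pi_ge0.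
rewrite ler_pdivrMr// ler_peMr ?mulr_ge0 ?pi_ge0// ler1n.
exact: m0.
Qed.

Let cos_angle : cos (angle m 1) != -1 :> R.
Proof.
have a0 : 0 < cos ((angle m 1 : R) / 2).
  apply: cos_gt0_pihalf; rewrite /angle mulr1.
  have p0 := @pi_gt0 R.
  have h : (0 : R) < 2 * pi / m%:R / 2 by rewrite !divr_gt0// mulr_gt0.
  apply/andP; split; first by apply: lt_trans h; rewrite oppr_lt0 divr_gt0.
  rewrite ltr_pM2r// ltr_pdivrMr// [ltLHS]mulrC ltr_pM2l// ltr_nat.
  exact: m2.
apply/eqP; rewrite [angle m 1]splitr cosD -!expr2 => h.
by have := exprn_gt0 2 a0; have := cos2Dsin2 ((angle m 1 : R) / 2); lra.
Qed.

(** The measure is invariant under the rotation by [2 * pi / m], which multiplies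
  the integrand by a scalar other than 1. *)
Lemma mode_orthogonal l l' : (0 < absz (l' - l) < m)%N ->
  L2_inner (nu alpha) (mode l) (mode l') = 0.
Proof.
move=> ll; pose h x := mode l x * (mode l' x)^*%C.
have th : ctame h.
  by apply: ctameM; [|apply: ctameJ]; exact: ctame_fourier_mode.
have hr x : h (rotation (angle m 1) x) = chi m (l' - l) * h x.
  rewrite /h !fourier_mode_rotation// conjcM chiJ opprK mulrACA -chiD.
  by rewrite [- l + l']addrC.
have e : Cintegral (nu alpha) disk h = chi m (l' - l) * Cintegral (nu alpha) disk h.
  rewrite -CintegralZ//; have [rh jh] := th.
  rewrite {1}/Cintegral -(Rintegral_rotation cos_angle angle01 rh).
  rewrite -(Rintegral_rotation cos_angle angle01 jh) /Cintegral.
  by congr (_ +i* _); apply: eq_Rintegral => x _; rewrite hr.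
apply/eqP; rewrite /L2_inner -/h.
have c1 := @chi_neq1 R m m0 _ ll.
have : (chi m (l' - l) - 1) * Cintegral (nu alpha) disk h = 0.
  by rewrite mulrBl mul1r -e subrr.
by move=> /eqP; rewrite mulf_eq0 subr_eq0 (negbTE c1).
Qed.

Definition mode_norm2 l : R := \int[nu alpha]_(x in disk) normc (mode l x) ^+ 2.

Lemma tame_mode_norm2 l : tame (fun x => normc (mode l x) ^+ 2).
Proof.
have [rw jw] := ctame_fourier_mode lambda m l.
by under eq_fun do rewrite normc2E !expr2; apply: tameD; exact: tameM.
Qed.

Lemma mode_norm2_ge l (B : set (plane R)) (c q : R) :
  measurable B -> B `<=` disk -> 0 <= c ->
  (forall x, B x -> c <= normc (mode l x) ^+ 2) ->
  (q%:E <= nu alpha B)%E -> c * q <= mode_norm2 l.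
Proof.
move=> mB BD c0 cB qB.
have ti := tame_integrable (nu alpha) (tame_mode_norm2 l).
have mD := @measurable_disk R.
rewrite -lee_fin /mode_norm2 /Rintegral fineK; last exact: integrable_fin_num.
have [mf _ _] := tame_mode_norm2 l.
have mE (E : set (plane R)) : measurable_fun E (fun x => (normc (mode l x) ^+ 2)%:E).
  by apply/measurable_EFinP; exact: measurable_funTS.
apply: (@le_trans _ _ (\int[nu alpha]_(x in B) (normc (mode l x) ^+ 2)%:E)%E); last first.
  by apply: ge0_subset_integral => // x _; rewrite lee_fin sqr_ge0.
apply: (@le_trans _ _ (\int[nu alpha]_(x in B) (cst c%:E x))%E).
  by rewrite integral_cst// EFinM; apply: lee_wpmul2l => //; rewrite lee_fin.
by apply: ge0_le_integral => // x Bx; rewrite lee_fin cB.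
Qed.

Lemma measurable_circle : measurable (@circle R).
Proof.
rewrite (_ : circle = rad2 @^-1` [set 1])//.
rewrite -[X in measurable X]setTI; exact: measurable_rad2.
Qed.

Lemma nu_circle_ge : (alpha%:num%:E <= nu alpha circle)%E.
Proof.
rewrite nuE arclength_circle arclengthT circle_lengthE -EFinM mulVf; last first.
  by rewrite mulf_neq0// gt_eqF// pi_gt0.
rewrite mulr1; apply: leeDr; apply: mule_ge0; first by rewrite lee_fin subr_ge0.
by apply: mule_ge0; [rewrite lee_fin area_inv_ge0 | exact: measure_ge0].
Qed.

Definition square (a : R) : set (plane R) := `[a, a + a] `*` `[a, a + a].

Lemma measurable_square a : measurable (square a).
Proof. exact: measurableX. Qed.

Lemma nu_square_ge (a : R) : 0 < a -> square a `<=` disk ->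
  (((1 - alpha%:num) * (a ^+ 2 / area))%:E <= nu alpha (square a))%E.
Proof.
move=> a0 sd; rewrite nuE (setIidl sd).
rewrite /lebesgue2 product_measure1E//= lebesgue_measure_itv/= lte_fin.
rewrite ltrDl a0 -EFinB addrK -!EFinM -expr2 [area^-1 * _]mulrC; apply: leeDl.
apply: mule_ge0; first by rewrite lee_fin.
by apply: mule_ge0; [rewrite lee_fin circle_length_inv_ge0 | exact: measure_ge0].
Qed.

End mode_geometry.

(** * Explicit bounds for the modes *)

Section mode_bounds.
Local Open Scope complex_scope.
Context {R : realType} (lambda : R) (m : nat).
Hypotheses (lambda0 : 0 < lambda) (m2 : (2 < m)%N).
Local Notation normc := ComplexField.Normc.normc.
Local Notation mode := (@fourier_mode R lambda m).
Local Notation A := (amplitude lambda).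
Local Notation D := (distortion lambda).

Let m0 : (0 < m)%N. Proof. exact: ltn_trans m2. Qed.
Let D0 : 0 < D. Proof. exact: distortion_gt0. Qed.
Let A0 n : 0 < A n. Proof. exact: amplitude_gt0. Qed.

Lemma mode_upper l x : ((absz l).*2 < m)%N -> disk x ->
  normc (mode l x) ^+ 2 <=
  (A (absz l) * (1 + D / (absz l).+1%:R)) ^+ 2 * rad2 x ^+ absz l.
Proof.
move=> lm dx; have := fourier_mode_norm lambda0 m0 lm dx.
have r0 := radius_ge0 x; have r1 := radius_le1 dx; rewrite -radius2.
set r := radius x in r0 r1 *; set n := absz l; set t : R := normc _.
rewrite ler_norml => /andP[_ h].
rewrite exprAC -exprMn.
have t0 : 0 <= t by exact: normc_ge0.
apply: lerXn2r; rewrite ?nnegrE//.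
  by rewrite !mulr_ge0 ?exprn_ge0 ?addr_ge0 ?divr_ge0// ltW.
have : D * r / n.+1%:R <= D / n.+1%:R.
  by rewrite ler_wpM2r ?invr_ge0// -[leRHS]mulr1 ler_wpM2l// ltW.
have Ar : 0 <= A n * r ^+ n by rewrite mulr_ge0 ?exprn_ge0// ltW.
move=> /(ler_wpM2l Ar) /(le_trans h) {h}; rewrite -/n; move: (D / _) (A n) (r ^+ n) => v a p; lra.
Qed.

Lemma mode_lower l x (d : R) : ((absz l).*2 < m)%N -> disk x ->
  D * radius x / (absz l).+1%:R <= d -> d <= 1 ->
  (A (absz l) * (1 - d)) ^+ 2 * rad2 x ^+ absz l <= normc (mode l x) ^+ 2.
Proof.
move=> lm dx hd d1; have := fourier_mode_norm lambda0 m0 lm dx.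
have r0 := radius_ge0 x; have r1 := radius_le1 dx; rewrite -radius2.
move: hd; set r := radius x in r0 r1 *; set n := absz l; set t : R := normc _ => hd.
rewrite ler_norml => /andP[h _].
rewrite exprAC -exprMn.
have t0 : 0 <= t by exact: normc_ge0.
have Ar : 0 <= A n * r ^+ n by rewrite mulr_ge0 ?exprn_ge0// ltW.
apply: lerXn2r; rewrite ?nnegrE//.
  by apply: mulr_ge0; [apply: mulr_ge0; [exact: ltW | rewrite subr_ge0] | exact: exprn_ge0].
move: hd h => /(ler_wpM2l Ar); move: (D * r / _) (A n) (r ^+ n) => v a p; lra.
Qed.

(** The square with opposite vertices [(side, side)] and [(2 * side, 2 * side)] lies
  within distance [4 * side = min (1, 1 / (2 * D))] of the origin, where the
  relative error of every mode is at most 1/2. *)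
Definition side : R := Num.min 1 (1 / (2 * D)) / 4.

Lemma side_gt0 : 0 < side.
Proof. by rewrite divr_gt0// lt_min ltr01 divr_gt0// mulr_gt0. Qed.

Lemma square_side x : square side x ->
  [/\ disk x, side ^+ 2 <= rad2 x & D * radius x <= 1 / 2].
Proof.
move=> [/=]; rewrite !in_itv/= => /andP[h1 h2] /andP[h3 h4].
have s0 := side_gt0.
have m1 : side * 4 <= 1 by rewrite /side divfK// ge_min lexx.
have mD : side * 4 <= 1 / (2 * D) by rewrite /side divfK// ge_min lexx orbT.
have r2 : rad2 x <= (side * 4) ^+ 2.
  rewrite /rad2; nra.
split.
- apply: le_trans r2 _; rewrite expr_le1//; nra.
- rewrite /rad2; nra.
- apply: (@le_trans _ _ (D * (side * 4))).
    apply: ler_wpM2l; first exact: ltW.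
    have s4 : 0 <= side * 4 by rewrite mulr_ge0// ltW.
    by rewrite -[leRHS](ger0_norm s4) -sqrtr_sqr ler_wsqrtr.
  move/(ler_wpM2l (ltW D0)): mD; move/le_trans; apply.
  by rewrite le_eqVlt; apply/orP; left; apply/eqP; field; rewrite gt_eqF.
Qed.

(** Up to the factors [1 - alpha] and [amplitude n ^+ 2], a lower bound for the
  squared norm of the modes of frequency [n] that is independent of [m]. *)
Definition small_mass (n : nat) : R :=
  (1 / 2) ^+ 2 * (side ^+ 2) ^+ n * (side ^+ 2 / area).

Lemma small_mass_gt0 n : 0 < small_mass n.
Proof.
have s0 := side_gt0; have a0 := @area_gt0 R.
by apply: mulr_gt0; [apply: mulr_gt0|apply: divr_gt0] => //; rewrite ?exprn_gt0//; lra.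
Qed.

Lemma small_mass_mono n k : (n <= k)%N -> small_mass k <= small_mass n.
Proof.
move=> nk; have s0 := side_gt0; have a0 := @area_gt0 R.
have s1 : side <= 1.
  by have : Num.min 1 (1 / (2 * D)) <= 1; [rewrite ge_min lexx | rewrite /side; lra].
apply: ler_wpM2r; first by rewrite divr_ge0 ?exprn_ge0// ltW.
apply: ler_wpM2l; first by rewrite exprn_ge0// divr_ge0.
by rewrite ler_wiXn2l// ?exprn_ge0 ?exprn_ile1// ltW.
Qed.

(** The Bessel function [J_n] may vanish at [lambda], so low modes can be small on
  the circle; near the origin their leading term dominates. *)
Lemma mode_norm2_small (alpha : {i01 R}) l : ((absz l).*2 < m)%N ->
  (1 - alpha%:num) * (A (absz l) ^+ 2 * small_mass (absz l)) <=
  mode_norm2 lambda m alpha l.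
Proof.
move=> lm; have s0 := side_gt0; set n := absz l.
have sd : square side `<=` disk by move=> x /square_side[].
have := @mode_norm2_ge R lambda m alpha l (square side)
  ((A n * (1 - 1 / 2)) ^+ 2 * (side ^+ 2) ^+ n) _ (@measurable_square R side) sd _ _
  (nu_square_ge alpha s0 sd).
move=> H; apply: le_trans (H _ _).
- by rewrite le_eqVlt /small_mass; apply/orP; left; apply/eqP; field;
    rewrite gt_eqF// area_gt0.
- by apply: mulr_ge0; [exact: sqr_ge0 | apply: exprn_ge0; exact: sqr_ge0].
- move=> x /square_side[dx sx Dx].
  apply: (@le_trans _ _ ((A n * (1 - 1 / 2)) ^+ 2 * rad2 x ^+ n)).
    apply: ler_wpM2l; first exact: sqr_ge0.
    by apply: lerXn2r; rewrite ?nnegrE ?sqr_ge0 ?rad2_ge0.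
  apply: mode_lower => //; last by lra.
  apply: le_trans Dx; rewrite ler_pdivrMr ?ltr0n// ler_peMr ?ler1n//.
  by rewrite mulr_ge0 ?radius_ge0// ltW.
Qed.

Lemma mode_norm2_circle (alpha : {i01 R}) l (d : R) : ((absz l).*2 < m)%N ->
  D / (absz l).+1%:R <= d -> d <= 1 ->
  (A (absz l) * (1 - d)) ^+ 2 * alpha%:num <= mode_norm2 lambda m alpha l.
Proof.
move=> lm hd d1.
apply: (mode_norm2_ge (@measurable_circle R) _ _ _ (nu_circle_ge alpha)).
- by move=> x; rewrite /circle/disk/= => ->.
- exact: sqr_ge0.
- move=> x cx.
  have rx : rad2 x = 1 by exact: cx.
  have dx : disk x by rewrite -[disk x]/(is_true (rad2 x <= 1)) rx.
  have h : D * radius x / (absz l).+1%:R <= d by rewrite /radius rx sqrtr1 mulr1.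
  by have := mode_lower lm dx h d1; rewrite rx expr1n mulr1.
Qed.

Lemma mode_norm2_uniform (alpha : {i01 R}) l : alpha%:num = 0 -> ((absz l).*2 < m)%N ->
  mode_norm2 lambda m alpha l <=
  (A (absz l) * (1 + D / (absz l).+1%:R)) ^+ 2 / (absz l).+1%:R.
Proof.
move=> al0 lm; have mD := @measurable_disk R.
set n := absz l; set c := (X in X / _); have c0 : 0 <= c by exact: sqr_ge0.
have a0 := @area_gt0 R.
have nuD (B : set (plane R)) : B `<=` disk ->
    nu alpha B = mscale (NngNum (@area_inv_ge0 R)) lebesgue2 B.
  move=> BD; rewrite nuE (setIidl BD).
  rewrite al0 subr0 mul1e mul0e adde0.
  by [].
have mr2 : measurable_fun disk (fun x : plane R => (rad2 x ^+ n)%:E).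
  by apply/measurable_EFinP; apply: measurable_funTS; apply: measurable_funX;
    exact: measurable_rad2.
have r20 (x : plane R) : disk x -> (0 <= (rad2 x ^+ n)%:E)%E.
  by move=> _; rewrite lee_fin exprn_ge0// rad2_ge0.
have [mf _ _] := tame_mode_norm2 lambda m l.
have ti := tame_integrable (nu alpha) (tame_mode_norm2 lambda m l).
rewrite -lee_fin /mode_norm2 /Rintegral fineK; last exact: integrable_fin_num.
apply: (@le_trans _ _ (\int[nu alpha]_(x in disk) (c%:E * (rad2 x ^+ n)%:E))%E).
  apply: ge0_le_integral => //.
  - by move=> x _; rewrite lee_fin sqr_ge0.
  - by apply/measurable_EFinP; exact: measurable_funTS.
  - by apply: measurable_funeM.
  - by move=> x dx; rewrite -EFinM lee_fin; exact: mode_upper.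
rewrite (@ge0_integralZl _ _ _ (nu alpha) _ mD _ mr2 _ r20)// (EFinM c); apply: lee_wpmul2l; first by rewrite lee_fin.
rewrite (eq_measure_integral (mscale (NngNum (@area_inv_ge0 R)) lebesgue2)); last first.
  by move=> B _ BD; exact: nuD.
have e1 := @ge0_integral_mscale _ _ _ lebesgue2 _ mD (NngNum (@area_inv_ge0 R)) _ mr2 r20.
rewrite {}e1.
apply: (@le_trans _ _ ((area^-1)%:E * (area / n.+1%:R)%:E)%E).
  apply: lee_wpmul2l; first by rewrite lee_fin area_inv_ge0.
  exact: moment_le.
by rewrite -EFinM lee_fin mulKf// gt_eqF.
Qed.

End mode_bounds.

(** * The kernel as a sum over modes *)

Section christoffel_formula.
Local Open Scope complex_scope.
Context {R : realType} (lambda : R).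
Hypothesis lambda0 : 0 < lambda.
Local Notation normc := ComplexField.Normc.normc.

Lemma Cspan_sub p q (F : 'I_p -> plane R -> R[i]) (G : 'I_q -> plane R -> R[i]) :
  (forall i, Cspan G (F i)) -> Cspan F `<=` Cspan G.
Proof.
move=> FG; have /choice[a aE] : forall i, exists a : 'I_q -> R[i],
    forall x, disk x -> F i x = \sum_(j < q) a j * G j x by exact: FG.
move=> f [c cE]; exists (fun j => \sum_(i < p) c i * a i j) => x dx.
rewrite cE//; under eq_bigr do rewrite aE// mulr_sumr.
rewrite exchange_big/=; apply: eq_bigr => j _; rewrite mulr_suml.
by apply: eq_bigr => i _; rewrite mulrA.
Qed.

Section basis.
Local Open Scope complex_scope.
Variables (m : nat) (alpha : {i01 R}).
Hypotheses (m2 : (2 < m)%N) (om : odd m) (alpha1 : alpha%:num < 1).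
Local Notation mode := (@fourier_mode R lambda m).
Local Notation norm2 := (mode_norm2 lambda m alpha).

Let m0 : (0 < m)%N. Proof. exact: ltn_trans m2. Qed.

Lemma mode_norm2_gt0 (k : 'I_m) : 0 < norm2 (centered k).
Proof.
apply: lt_le_trans (mode_norm2_small lambda0 m2 alpha (centered_small k om)).
rewrite mulr_gt0 ?subr_gt0// mulr_gt0 ?small_mass_gt0//.
by rewrite exprn_gt0// amplitude_gt0.
Qed.

Let s (k : 'I_m) : R := (Num.sqrt (norm2 (centered k)))^-1.

Let s_gt0 k : 0 < s k.
Proof. by rewrite invr_gt0 sqrtr_gt0 mode_norm2_gt0. Qed.

Let s2 k : s k * s k = (norm2 (centered k))^-1.
Proof. by rewrite -expr2 exprVn sqr_sqrtr// ltW// mode_norm2_gt0. Qed.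

Definition mode_basis (k : 'I_m) (x : plane R) : R[i] :=
  (s k)%:C * mode (centered k) x.

Lemma ctame_mode_basis k : ctame (mode_basis k).
Proof. by apply: ctameM; [exact: ctame_cst | exact: ctame_fourier_mode]. Qed.

Lemma mode_basis_orthonormal : is_orthonormal (nu alpha) mode_basis.
Proof.
move=> j k.
have tm i := ctame_fourier_mode lambda m (centered i : int).
have -> : L2_inner (nu alpha) (mode_basis j) (mode_basis k) =
    ((s j * s k)%:C) * L2_inner (nu alpha) (mode (centered j)) (mode (centered k)).
  rewrite /L2_inner -CintegralZ; last by apply: ctameM; [|apply: ctameJ]; exact: tm.
  congr Cintegral; apply/funext => x; rewrite /mode_basis conjcM conjc_real.
  by rewrite (rmorphM (real_complex R)) mulrACA.
have [->|jk] := eqVneq j k.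
  rewrite L2_inner_norm2; last exact: tm.
  by rewrite -(rmorphM (real_complex R)) s2 -/(norm2 _) mulVf// gt_eqF// mode_norm2_gt0.
rewrite mode_orthogonal ?mulr0// (centered_lt k j) andbT absz_gt0 subr_eq0.
by rewrite (inj_eq (@centered_inj m)) eq_sym.
Qed.

Lemma Cspan_mode_basis : Ve lambda m = Cspan mode_basis.
Proof.
apply/seteqP; split; apply: Cspan_sub => i.
- exists (fun k => chi m (centered i * centered k) * (s k)%:C^-1) => x _.
  rewrite -[LHS]/(plane_wave lambda m (centered i) x) plane_wave_fourier//.
  apply: eq_bigr => k _; rewrite /mode_basis -mulrA mulKf//.
  by rewrite (inj_eq (@complexI R)) gt_eqF.
- exists (fun k => (s i)%:C * (m%:R^-1 * chi m (- (centered k * centered i)))) => x _.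
  rewrite /mode_basis /fourier_mode mulrA mulr_sumr; apply: eq_bigr => k _.
  by rewrite !mulrA.
Qed.

(** The normalised modes are an orthonormal basis: the discrete Fourier transform
  is invertible and no mode vanishes. *)
Lemma K_modes : exists x : plane R, [/\ disk x,
  K (Ve lambda m) (nu alpha) =
    \sum_(k < m) normc (mode (centered k) x) ^+ 2 / norm2 (centered k) &
  forall y, disk y ->
    \sum_(k < m) normc (mode (centered k) y) ^+ 2 / norm2 (centered k) <=
    K (Ve lambda m) (nu alpha)].
Proof.
have [x [dx Kx Kmax]] := K_orthonormal_basis ctame_mode_basis
  (conj Cspan_mode_basis mode_basis_orthonormal).
have e y : sum_sqr_norm mode_basis y =
    \sum_(k < m) normc (mode (centered k) y) ^+ 2 / norm2 (centered k).
  apply: eq_bigr => k _; rewrite ComplexField.Normc.normcM exprMn mulrC.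
  by rewrite normcR real_normK ?num_real// [s k ^+ 2]expr2 s2.
by exists x; split=> [//||y dy]; rewrite -e// Kmax.
Qed.

End basis.
End christoffel_formula.

(** * Growth of the kernel *)

Section growth.
Context {R : realType} (lambda : R).
Hypothesis lambda0 : 0 < lambda.
Local Notation normc := ComplexField.Normc.normc.
Local Notation A := (amplitude lambda).
Local Notation D := (distortion lambda).

Let A0 n : 0 < A n. Proof. exact: amplitude_gt0. Qed.
Let D0 : 0 < D. Proof. exact: distortion_gt0. Qed.

(** For [l] large against [D] the ratio is close to [l + 1], since the squared norm
  is close to [amplitude l ^+ 2 / (l + 1)]; for smaller [l] the left-hand side is
  negative. *)
Lemma mode_ratio_uniform m (alpha : {i01 R}) (k : 'I_m) :
  (2 < m)%N -> odd m -> alpha%:num = 0 ->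
  (absz (centered k)).+1%:R / 2 - 5 * D <=
  normc (fourier_mode lambda m (centered k) (1, 0)) ^+ 2 /
    mode_norm2 lambda m alpha (centered k).
Proof.
move=> m2 om al0; have lm := centered_small k om; set n := absz _ in lm *.
have alpha1 : alpha%:num < 1 by rewrite al0.
have N0 := mode_norm2_gt0 lambda0 m2 om alpha1 k.
have N1 := mode_norm2_uniform lambda0 m2 al0 lm.
set N := mode_norm2 _ _ _ _ in N0 N1 *.
have [hD|hD] := leP (10 * D) n.+1%:R; last first.
  apply: (@le_trans _ _ 0); first by lra.
  by rewrite divr_ge0 ?sqr_ge0// ltW.
have n0 : 0 < n.+1%:R :> R by rewrite ltr0n.
have hd : D / n.+1%:R <= 1 / 10 by rewrite ler_pdivrMr//; lra.
have rx : rad2 (1, 0) = 1 :> R by rewrite /rad2/= expr1n expr0n/= addr0.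
have dx : disk (1, 0 : R) by rewrite -[disk _]/(is_true (rad2 _ <= 1)) rx.
have lo : (A n * (1 - 1 / 10)) ^+ 2 <=
    normc (fourier_mode lambda m (centered k) (1, 0)) ^+ 2.
  have h : D * radius (1, 0) / n.+1%:R <= 1 / 10 by rewrite /radius rx sqrtr1 mulr1.
  have h1 : 1 / 10 <= 1 :> R by lra.
  by have := mode_lower lambda0 m2 lm dx h h1; rewrite rx expr1n mulr1.
have hi : N * n.+1%:R <= (A n * (11 / 10)) ^+ 2.
  rewrite -ler_pdivlMr//; apply: le_trans N1 _; rewrite ler_wpM2r ?invr_ge0//.
  have An := A0 n; have Dn : 0 <= D / n.+1%:R by rewrite divr_ge0// ltW.
  apply: lerXn2r; rewrite ?nnegrE.
  - by apply: mulr_ge0; [exact: ltW | exact: addr_ge0].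
  - by apply: mulr_ge0; [exact: ltW | lra].
  - by apply: ler_wpM2l; [exact: ltW | move: hd; move: (D / _) => y; lra].
apply: (@le_trans _ _ (n.+1%:R / 2)); first by rewrite lerBlDr lerDl mulr_ge0// ltW.
rewrite ler_pdivlMr//; apply: le_trans lo.
have aux (a b : R) : b <= (a * (11 / 10)) ^+ 2 -> b / 2 <= (a * (1 - 1 / 10)) ^+ 2.
  by have := sqr_ge0 a; lra.
by rewrite mulrAC [n.+1%:R * N]mulrC aux.
Qed.

Lemma sum_mode_ratio (L : nat) (c : R) :
  L%:R ^+ 2 / 2 - c * (L.*2.+1)%:R <=
  \sum_(i < L) (i.+2%:R / 2 - c) + \sum_(i < L.+1) (i.+1%:R / 2 - c).
Proof.
elim: L => [|L IH]; first by rewrite big_ord0 big_ord1 double0 expr0n/=; lra.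
rewrite big_ord_recr/= [X in _ <= _ + X]big_ord_recr/= doubleS.
move: IH; set S := \sum_(i < L) _; set T := \sum_(i < L.+1) _.
have e n : n.+1%:R = n%:R + 1 :> R by rewrite natr1.
rewrite -mul2n (e (2 * L)%N.+2) (e (2 * L)%N.+1) (e (2 * L)%N) (e L.+1) (e L) natrM.
by move: (L%:R : R) S T => l S T; lra.
Qed.

Lemma K_uniform_ge m (alpha : {i01 R}) : (2 < m)%N -> odd m -> alpha%:num = 0 ->
  (m./2)%:R ^+ 2 / 2 - 5 * D * m%:R <= K (Ve lambda m) (nu alpha).
Proof.
move=> m2 om al0.
have alpha1 : alpha%:num < 1 by rewrite al0.
have [_ [_ _ Kmax]] := K_modes lambda0 m2 om alpha1.
have dx : disk (1, 0 : R) by rewrite /disk/= expr1n expr0n/= addr0.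
apply: le_trans (Kmax _ dx).
have mE : m = (m./2).*2.+1 by have := odd_double_half m; rewrite om.
rewrite [in X in _ - _ * X <= _]mE.
apply: le_trans (sum_mode_ratio _ _) _.
rewrite -(sum_centered (fun n => n.+1%:R / 2 - 5 * D) om).
by apply: ler_sum => k _; exact: mode_ratio_uniform.
Qed.

(** The circle alone, of mass [alpha], carries a squared norm comparable to the
  maximum of the squared modulus of a high mode. *)
Lemma mode_ratio_mixed m (alpha : {i01 R}) (k : 'I_m) (x : plane R) (d : R) :
  (2 < m)%N -> odd m -> 0 < alpha%:num < 1 -> disk x ->
  D / (absz (centered k)).+1%:R <= d -> d < 1 ->
  normc (fourier_mode lambda m (centered k) x) ^+ 2 /
    mode_norm2 lambda m alpha (centered k) <=
  ((1 + d) / (1 - d)) ^+ 2 / alpha%:num.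
Proof.
move=> m2 om /andP[a0 a1] dx hd d1; have lm := centered_small k om.
set n := absz _ in lm hd *.
have N0 := mode_norm2_gt0 lambda0 m2 om a1 k.
have N1 := mode_norm2_circle lambda0 m2 alpha lm hd (ltW d1).
set N := mode_norm2 _ _ _ _ in N0 N1 *.
have An := A0 n; have Dn : 0 <= D / n.+1%:R by rewrite divr_ge0// ltW.
have d0 : 0 <= d := le_trans Dn hd.
have hi := mode_upper lambda0 m2 lm dx.
rewrite ler_pdivrMr//; apply: le_trans hi _.
apply: (@le_trans _ _ ((A n * (1 + d)) ^+ 2)).
  rewrite -[leRHS]mulr1; apply: ler_pM; rewrite ?sqr_ge0 ?exprn_ge0 ?rad2_ge0//.
    apply: lerXn2r; rewrite ?nnegrE.
    - by apply: mulr_ge0; [exact: ltW | exact: addr_ge0].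
    - by apply: mulr_ge0; [exact: ltW | exact: addr_ge0].
    - by apply: ler_wpM2l; [exact: ltW | rewrite lerD2l].
  by rewrite exprn_ile1// rad2_ge0.
apply: (@le_trans _ _ (((1 + d) / (1 - d)) ^+ 2 / alpha%:num *
    ((A n * (1 - d)) ^+ 2 * alpha%:num))); last first.
  by apply: ler_wpM2l => //; rewrite divr_ge0 ?sqr_ge0// ltW.
rewrite le_eqVlt; apply/orP; left; apply/eqP; field.
by rewrite gt_eqF//= subr_eq0 gt_eqF.
Qed.

Definition small_ratio (alpha : {i01 R}) (n : nat) : R :=
  (1 + D) ^+ 2 / ((1 - alpha%:num) * small_mass lambda n).

Lemma mode_ratio_small m (alpha : {i01 R}) (k : 'I_m) (x : plane R) n1 :
  (2 < m)%N -> odd m -> alpha%:num < 1 -> disk x ->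
  (absz (centered k) <= n1)%N ->
  normc (fourier_mode lambda m (centered k) x) ^+ 2 /
    mode_norm2 lambda m alpha (centered k) <= small_ratio alpha n1.
Proof.
move=> m2 om a1 dx nn; have lm := centered_small k om; set n := absz _ in lm nn *.
have N0 := mode_norm2_gt0 lambda0 m2 om a1 k.
have N1 := mode_norm2_small lambda0 m2 alpha lm.
set N := mode_norm2 _ _ _ _ in N0 N1 *.
have An := A0 n.
have hi := mode_upper lambda0 m2 lm dx.
have S0 := small_mass_gt0 lambda0 n1.
have S1 := small_mass_mono lambda0 nn.
have a1' : 0 < 1 - alpha%:num by rewrite subr_gt0.
rewrite ler_pdivrMr//; apply: le_trans hi _.
apply: (@le_trans _ _ ((A n * (1 + D)) ^+ 2)).
  have Dn : D / n.+1%:R <= D by rewrite ler_pdivrMr ?ltr0n// ler_peMr ?ler1n// ltW.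
  have Dn0 : 0 <= D / n.+1%:R by rewrite divr_ge0// ltW.
  rewrite -[leRHS]mulr1; apply: ler_pM; rewrite ?sqr_ge0 ?exprn_ge0 ?rad2_ge0//.
    apply: lerXn2r; rewrite ?nnegrE.
    - by apply: mulr_ge0; [exact: ltW | exact: addr_ge0].
    - by apply: mulr_ge0; [exact: ltW | rewrite addr_ge0// ltW].
    - by apply: ler_wpM2l; [exact: ltW | rewrite lerD2l].
  by rewrite exprn_ile1// rad2_ge0.
apply: (@le_trans _ _ (small_ratio alpha n1 *
    ((1 - alpha%:num) * (A n ^+ 2 * small_mass lambda n1)))).
  rewrite le_eqVlt /small_ratio; apply/orP; left; apply/eqP; field.
  by rewrite !gt_eqF.
apply: ler_wpM2l.
  by rewrite divr_ge0 ?sqr_ge0// mulr_ge0// ltW.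
apply: le_trans N1; apply: ler_wpM2l; first exact: ltW.
by apply: ler_wpM2l => //; exact: sqr_ge0.
Qed.

Lemma sum_lt_le (n n1 : nat) : \sum_(i < n) ((i < n1)%N%:R : R) <= n1%:R.
Proof.
suff -> : \sum_(i < n) ((i < n1)%N%:R : R) = (minn n n1)%:R by rewrite ler_nat geq_minr.
elim: n => [|n IH]; first by rewrite big_ord0 min0n.
by rewrite big_ord_recr/= IH -natrD; congr (_%:R); case: ltnP => /=; lia.
Qed.

(** Each high mode contributes at most [C2 / alpha]. The number of remaining
  frequencies and their contributions are bounded independently of [m]. *)
Lemma K_mixed_le (alpha : {i01 R}) (C2 : R) : 0 < alpha%:num < 1 -> 1 < C2 ->
  exists C1 : R, forall m, (2 < m)%N -> odd m ->
    K (Ve lambda m) (nu alpha) <= C1 + C2 * (m%:R / alpha%:num).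
Proof.
move=> a01 C21; have /andP[a0 a1] := a01.
(* the denominator 6 ensures [(1 + d) ^+ 2 <= (1 + eta) * (1 - d) ^+ 2] *)
pose eta : R := Num.min (C2 - 1) 1; pose d : R := eta / 6.
have eta0 : 0 < eta by rewrite lt_min ltr01 andbT subr_gt0.
have eta1 : eta <= 1 by rewrite ge_min lexx orbT.
have etaC : 1 + eta <= C2 by rewrite addrC -lerBrDr ge_min lexx.
have d0 : 0 < d by rewrite divr_gt0.
have d1 : d < 1 by rewrite /d; lra.
have dC : ((1 + d) / (1 - d)) ^+ 2 <= C2.
  apply: le_trans etaC; rewrite expr_div_n ler_pdivrMr; last first.
    by rewrite exprn_gt0// subr_gt0.
  by rewrite /d; nra.
pose n1 := (Num.truncn (D / d)).+1.
have n1P n : (n1 <= n)%N -> D / n.+1%:R <= d.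
  move=> n1n; rewrite ler_pdivrMr ?ltr0n// mulrC -ler_pdivrMr//.
  have h := truncnS_gt (D / d).
  by apply: ltW; apply: lt_le_trans h _; rewrite ler_nat ltnW.
pose G := small_ratio alpha n1.
have G0 : 0 <= G.
  rewrite divr_ge0 ?sqr_ge0// mulr_ge0 ?subr_ge0// ltW//.
  exact: small_mass_gt0.
exists (2 * n1%:R * G) => m m2 om.
have [x [dx -> _]] := K_modes lambda0 m2 om a1.
pose F n : R := C2 / alpha%:num + G * (n < n1)%N%:R.
have C20 : 0 <= C2 / alpha%:num by rewrite divr_ge0// ltW//; lra.
apply: (@le_trans _ _ (\sum_(k < m) F (absz (centered k)))).
  apply: ler_sum => k _; rewrite /F.
  have [h|h] := ltnP (absz (centered k)) n1.
    rewrite mulr1 -[leLHS]add0r; apply: lerD => //.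
    by apply: mode_ratio_small => //; exact: ltnW.
  rewrite mulr0 addr0.
  apply: le_trans (mode_ratio_mixed m2 om a01 dx (n1P _ h) d1) _.
  by apply: ler_wpM2r => //; rewrite invr_ge0 ltW.
rewrite big_split/= sumr_const card_ord addrC -mulr_sumr; apply: lerD; last first.
  by rewrite -[leLHS]mulr_natr [leRHS]mulrA [leLHS]mulrAC.
rewrite [leRHS]mulrC; apply: ler_wpM2l => //.
rewrite (sum_centered (fun n => (n < n1)%N%:R) om) mulrDl mul1r; apply: lerD.
  apply: le_trans (sum_lt_le m./2 n1); apply: ler_sum => i _.
  by rewrite ler_nat; case: ltnP => // h; rewrite (ltn_trans _ h).
exact: sum_lt_le.
Qed.

End growth.

Theorem theorem4p2 (R : realType) (lambda : R) (hlambda : 0 < lambda) :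
  (forall c1 : R, c1 < 1 / 16 ->
    exists c0 : R, \forall m \near \oo, odd m ->
      K (Ve lambda m) (nu 0%:i01) >= c0 + c1 * m%:R ^+ 2) /\
  (forall alpha : {i01 R}, 0 < alpha%:num < 1 ->
    forall C2 : R, C2 > 1 ->
    exists C1 : R, \forall m \near \oo, odd m ->
      K (Ve lambda m) (nu alpha) <= C1 + C2 * (m%:R / alpha%:num)).
Proof.
split=> [c1 hc1|alpha a01 C2 C21]; last first.
  have [C1 hC1] := K_mixed_le hlambda a01 C21.
  by exists C1; exists 3%N => // m /= m2 om; exact: hC1.
exists 0; have D0 := distortion_gt0 hlambda; set D := distortion lambda in D0.
near=> m => om.
have m2 : (2 < m)%N by near: m; exact: nbhs_infty_gt.
have mD : 4 + 80 * D <= m%:R by near: m; exact: nbhs_infty_ger.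
apply: le_trans (@K_uniform_ge _ _ hlambda m 0%:i01 m2 om erefl).
have mE : m%:R = 2 * (m./2)%:R + 1 :> R.
  by rewrite -[in LHS](odd_double_half m) om -muln2 natrD natrM addrC mulrC.
rewrite add0r -/D.
have c1m : c1 * m%:R ^+ 2 <= 1 / 16 * m%:R ^+ 2 by rewrite ler_wpM2r ?sqr_ge0// ltW.
apply: le_trans c1m _; have -> : (m./2)%:R = (m%:R - 1) / 2 :> R by rewrite mE; field.
by move: mD; move: (m%:R : R) => M mD; nra.
Unshelve. all: by end_near. Qed.
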